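(* Let $\mathcal{A}$ be a quasi-abelian category equipped with a rank function and a $\Lambda$-valued slope function $\mu$, where $\Lambda$ is a totally ordered, uniquely divisible abelian group. If $f: M \to N$ is a morphism in $W\mathcal{A}^{\mathrm{pre}}$ with $M \in W\mathcal{A}^{\mathrm{pre}}_{\mathrm{udq}}$ and $N \in W\mathcal{A}^{\mathrm{pre}}_{\mathrm{uds}}$, then the cokernel of $f$ in $W\mathcal{A}^{\mathrm{pre}}$ is computed in $\mathrm{Fun}(\Lambda,\mathcal{A})$ (i.e. it is also the cokernel of $f$ in $\mathrm{Fun}(\Lambda,\mathcal{A})$) and it lies in $W\mathcal{A}^{\mathrm{pre}}_{\mathrm{uds}}$. In particular, $\mathrm{Coker} f \in W\mathcal{A}$ when $N \in W\mathcal{A}$. Dually, $\mathrm{Ker} f \in W\mathcal{A}^{\mathrm{pre}}_{\mathrm{udq}}$, and it lies in $W\mathcal{A}$ when $M \in W\mathcal{A}$.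
   Context: All categories are essentially small. In an additive category with kernels and cokernels, put $\mathrm{Coim} f = \mathrm{Coker}(\ker f)$ and $\mathrm{Im} f = \mathrm{Ker}(\mathrm{coker} f)$; $f$ is strict if the canonical morphism $\mathrm{Coim} f \to \mathrm{Im} f$ is an isomorphism. Strict monics are exactly the kernels, strict epis exactly the cokernels. Subobject = monic, quotient = epi; they are called strict if the morphism is strict. A sequence $0 \to M \xrightarrow{f} N \xrightarrow{g} P \to 0$ is short exact if $f = \ker g$ and $g = \mathrm{coker} f$. A quasi-abelian category is an additive category with kernels and cokernels in which kernels are stable under pushout and cokernels are stable under pullback. Slope functions. A rank function $\mathrm{rk}$ assigns to each isomorphism class of $\mathcal{A}$ a natural number, is additive along short exact sequences, and is nonzero on nonzero objects. A degree function $\deg$ assigns to each isomorphism class an element of $\Lambda$ and is additive along short exact sequences. $\mu = \deg/\mathrm{rk}$ (defined on nonzero objects) is a slope function if for every epi-monic $\varphi: M \to N$ in $\mathcal{A}$ one has $\mu(M) \leq \mu(N)$, with equality if and only if $\varphi$ is an isomorphism. A nonzero object $M$ is semistable if $\mu(N) \leq \mu(M)$ for all nonzero subobjects $N \to M$. $\mathcal{A}(\lambda) \subset \mathcal{A}$ denotes the full subcategory consisting of zero and the semistable objects of slope $\lambda$. Filtrations. $\mathrm{Fun}(\Lambda,\mathcal{A})$ is the category of functors from the totally ordered set $\Lambda$ to $\mathcal{A}$. $W\mathcal{A}^{\mathrm{pre}} \subset \mathrm{Fun}(\Lambda,\mathcal{A})$ is the full subcategory of finite ascending filtrations: functors $\lambda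 \mapsto W_{\leq\lambda}M$ with colimit $M$ such that each $W_{\leq\lambda}M \to M$ is a strict monic and there are finitely many breaks $\lambda_0 < \dots < \lambda_r$ such that $W_{\leq\lambda}M = 0$ for $\lambda < \lambda_0$, $W_{\leq\lambda}M = W_{\leq\lambda_{i-1}}M$ for $\lambda_{i-1} \leq \lambda < \lambda_i$, and $W_{\leq\lambda}M = M$ for $\lambda \geq \lambda_r$ (no breaks if $M=0$). Objects are written $(M,W)$ or $M$. Put $W_{<\lambda}M = \mathrm{colim}_{\lambda'<\lambda} W_{\leq\lambda'}M$ and $\mathrm{gr}^W_\lambda M = \mathrm{Coker}(W_{<\lambda}M \hookrightarrow W_{\leq\lambda}M)$. $W\mathcal{A}^{\mathrm{pre}}$ is an additive category with kernels and cokernels. $W\mathcal{A} \subset W\mathcal{A}^{\mathrm{pre}}$ is the full subcategory of $(M,W)$ with $\mathrm{gr}^W_\lambda M \in \mathcal{A}(\lambda)$ for all $\lambda \in \Lambda$. $W\mathcal{A}^{\mathrm{pre}}_{\mathrm{uds}} \subset W\mathcal{A}^{\mathrm{pre}}$ is the full subcategory of $(M,W)$ such that for all $\lambda \in \Lambda$, all nonzero subobjects of $\mathrm{gr}^W_\lambda M$ have slope $\leq \lambda$. $W\mathcal{A}^{\mathrm{pre}}_{\mathrm{udq}} \subset W\mathcal{A}^{\mathrm{pre}}$ is the full subcategory of $(M,W)$ such that for all $\lambda$, all nonzero quotients of $\mathrm{gr}^W_\lambda M$ have slope $\geq \lambda$. *)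

(* Defs.v *)
From mathcomp Require Import all_boot all_order all_algebra.
From mathcomp Require Import boolp classical_sets.

Set Implicit Arguments.
Unset Strict Implicit.
Unset Printing Implicit Defensive.

Import Order.TTheory GRing.Theory Num.Theory.

(** * Categories *)

Record category := Category {
  obj :> Type;
  mor : obj -> obj -> Type;
  idm : forall X, mor X X;
  compose : forall X Y Z, mor Y Z -> mor X Y -> mor X Z;
  comp_idl : forall X Y (f : mor X Y), compose (idm Y) f = f;
  comp_idr : forall X Y (f : mor X Y), compose f (idm X) = f;
  comp_assoc : forall X Y Z T (h : mor Z T) (g : mor Y Z) (f : mor X Y),
    compose h (compose g f) = compose (compose h g) f }.

Arguments mor {c} X Y.
Arguments idm {c} X.
Arguments compose {c X Y Z} g f.

Notation "g '\oc' f" := (compose g f) (at level 50, left associativity).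

Section Notions.
Variable C : category.
Implicit Types X Y Z T : C.

Definition is_iso X Y (f : mor X Y) : Prop :=
  exists g : mor Y X, g \oc f = idm X /\ f \oc g = idm Y.

Definition is_monic X Y (f : mor X Y) : Prop :=
  forall T (u v : mor T X), f \oc u = f \oc v -> u = v.

Definition is_epi X Y (f : mor X Y) : Prop :=
  forall T (u v : mor Y T), u \oc f = v \oc f -> u = v.

Definition is_zero Z : Prop :=
  (forall X, exists! f : mor X Z, True) /\ (forall X, exists! f : mor Z X, True).

(* In a category with a zero object this is the usual zero morphism; in the
   preadditive case it is the neutral element of the group of morphisms.
   Kernels and cokernels therefore make sense in any category, without
   reference to a chosen additive structure. *)
Definition zero_mor X Y (f : mor X Y) : Prop :=
  exists Z (v : mor Z Y) (u : mor X Z), is_zero Z /\ f = v \oc u.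

Definition is_ker X Y (f : mor X Y) K (k : mor K X) : Prop :=
  zero_mor (f \oc k) /\
  forall T (h : mor T X), zero_mor (f \oc h) -> exists! u : mor T K, k \oc u = h.

Definition is_coker X Y (f : mor X Y) Q (q : mor Y Q) : Prop :=
  zero_mor (q \oc f) /\
  forall T (h : mor Y T), zero_mor (h \oc f) -> exists! u : mor Q T, u \oc q = h.

Definition is_coim X Y (f : mor X Y) I (c : mor X I) : Prop :=
  exists K (k : mor K X), is_ker f k /\ is_coker k c.

Definition is_im X Y (f : mor X Y) I (i : mor I Y) : Prop :=
  exists Q (q : mor Y Q), is_coker f q /\ is_ker q i.

Definition strict X Y (f : mor X Y) : Prop :=
  exists I (c : mor X I) J (i : mor J Y) (u : mor I J),
    [/\ is_coim f c, is_im f i, f = i \oc u \oc c & is_iso u].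

Definition short_exact M N P (f : mor M N) (g : mor N P) : Prop :=
  is_ker g f /\ is_coker f g.

Definition is_pushout X Y Z P (f : mor X Y) (g : mor X Z)
    (f' : mor Z P) (g' : mor Y P) : Prop :=
  g' \oc f = f' \oc g /\
  forall T (a : mor Y T) (b : mor Z T), a \oc f = b \oc g ->
    exists! u : mor P T, u \oc g' = a /\ u \oc f' = b.

Definition is_pullback X Y Z P (f : mor Y X) (g : mor Z X)
    (f' : mor P Z) (g' : mor P Y) : Prop :=
  f \oc g' = g \oc f' /\
  forall T (a : mor T Y) (b : mor T Z), f \oc a = g \oc b ->
    exists! u : mor T P, g' \oc u = a /\ f' \oc u = b.

Definition is_kernel X Y (f : mor X Y) : Prop :=
  exists Z (g : mor Y Z), is_ker g f.

Definition is_cokernel X Y (f : mor X Y) : Prop :=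
  exists Z (g : mor Z X), is_coker g f.

Definition additive_cat : Prop :=
  exists (add : forall X Y, mor X Y -> mor X Y -> mor X Y)
         (zero : forall X Y, mor X Y)
         (opp : forall X Y, mor X Y -> mor X Y),
    [/\ (forall X Y, [/\ associative (@add X Y), commutative (@add X Y),
                         left_id (zero X Y) (@add X Y)
                       & left_inverse (zero X Y) (@opp X Y) (@add X Y)]),
        (forall X Y Z (h : mor Y Z) (f g : mor X Y),
           h \oc add _ _ f g = add _ _ (h \oc f) (h \oc g)),
        (forall X Y Z (f g : mor Y Z) (h : mor X Y),
           add _ _ f g \oc h = add _ _ (f \oc h) (g \oc h)),
        (exists Z, is_zero Z)
      & forall X Y, exists B (i : mor X B) (j : mor Y B)
                             (p : mor B X) (q : mor B Y),
          [/\ p \oc i = idm X, q \oc j = idm Y,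
              p \oc j = zero _ _, q \oc i = zero _ _
            & add _ _ (i \oc p) (j \oc q) = idm B]].

Definition quasi_abelian : Prop :=
  [/\ additive_cat,
      (forall X Y (f : mor X Y), exists K (k : mor K X), is_ker f k),
      (forall X Y (f : mor X Y), exists Q (q : mor Y Q), is_coker f q),
      (forall X Y Z P (f : mor X Y) (g : mor X Z) (f' : mor Z P) (g' : mor Y P),
         is_pushout f g f' g' -> is_kernel f -> is_kernel f')
    & forall X Y Z P (f : mor Y X) (g : mor Z X) (f' : mor P Z) (g' : mor P Y),
         is_pullback f g f' g' -> is_cokernel f -> is_cokernel f'].

End Notions.

#[local] Obligation Tactic := idtac.

(** * Functor categories, full subcategories, posets *)

Record functor (J C : category) := Functor {
  fobj :> J -> C;
  fmap : forall i j, mor i j -> mor (fobj i) (fobj j);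
  fmap_id : forall i, fmap (idm i) = idm (fobj i);
  fmap_comp : forall i j k (g : mor j k) (f : mor i j),
    fmap (g \oc f) = fmap g \oc fmap f }.

Arguments fmap {J C} F {i j} a : rename.

Record nattrans (J C : category) (F G : functor J C) := NatTrans {
  component :> forall i, mor (F i) (G i);
  naturality : forall i j (a : mor i j),
    component j \oc fmap F a = fmap G a \oc component i }.

Section FunctorCategory.
Variables J C : category.

Lemma nattrans_ext (F G : functor J C) (s t : nattrans F G) :
  (forall i, s i = t i) -> s = t.
Proof.
case: s t => [s sn] [t tn] /= st.
have e : s = t by apply: functional_extensionality_dep.
by subst t; congr NatTrans; apply: Prop_irrelevance.
Qed.

Program Definition nat_id (F : functor J C) : nattrans F F :=
  @NatTrans _ _ F F (fun i => idm (F i)) _.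
Next Obligation. by move=> F i j a; rewrite comp_idl comp_idr. Qed.

Program Definition nat_comp (F G H : functor J C)
    (t : nattrans G H) (s : nattrans F G) : nattrans F H :=
  @NatTrans _ _ F H (fun i => t i \oc s i) _.
Next Obligation.
by move=> F G H t s i j a; rewrite -comp_assoc naturality !comp_assoc naturality.
Qed.

Program Definition Fun : category :=
  @Category (functor J C) (@nattrans J C) nat_id nat_comp _ _ _.
Next Obligation. by move=> F G f; apply: nattrans_ext => i /=; rewrite comp_idl. Qed.
Next Obligation. by move=> F G f; apply: nattrans_ext => i /=; rewrite comp_idr. Qed.
Next Obligation. by move=> *; apply: nattrans_ext => i /=; rewrite comp_assoc. Qed.

End FunctorCategory.

Definition full_subcat (C : category) (P : C -> Prop) : category :=
  @Category {X : C | P X} (fun X Y => mor (sval X) (sval Y))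
    (fun X => idm (sval X)) (fun _ _ _ g f => g \oc f)
    (fun _ _ => @comp_idl _ _ _) (fun _ _ => @comp_idr _ _ _)
    (fun _ _ _ _ => @comp_assoc _ _ _ _ _).

Program Definition restrict (J C : category) (P : J -> Prop) (F : functor J C) :
    functor (full_subcat P) C :=
  @Functor (full_subcat P) C (fun i => F (sval i))
    (fun i j a => @fmap _ _ F (sval i) (sval j) a) _ _.
Next Obligation. by move=> *; apply: fmap_id. Qed.
Next Obligation. by move=> *; apply: fmap_comp. Qed.

Program Definition poset_cat (d : Order.disp_t) (T : porderType d) : category :=
  @Category T (fun x y => (x <= y)%O) (fun x => lexx x)
    (fun _ _ _ yz xy => le_trans xy yz) _ _ _.
Next Obligation. by move=> *; apply: bool_irrelevance. Qed.
Next Obligation. by move=> *; apply: bool_irrelevance. Qed.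
Next Obligation. by move=> *; apply: bool_irrelevance. Qed.

Section Colimits.
Variables (J C : category) (F : functor J C).

Definition is_cocone (X : C) (c : forall i, mor (F i) X) : Prop :=
  forall i j (a : mor i j), c j \oc fmap F a = c i.

Definition is_colim (X : C) (c : forall i, mor (F i) X) : Prop :=
  is_cocone c /\
  forall T (t : forall i, mor (F i) T), is_cocone t ->
    exists! u : mor X T, forall i, u \oc c i = t i.

End Colimits.

(** * Rank, degree and slope *)

Local Open Scope ring_scope.

Definition totally_ordered_group (L : porderZmodType) : Prop :=
  total (<=%R : rel L) /\ forall x y z : L, x <= y -> x + z <= y + z.

Definition uniquely_divisible (L : zmodType) : Prop :=
  forall (n : nat) (x : L), (0 < n)%N -> exists! y : L, y *+ n = x.

Section Slopes.
Variables (A : category) (L : porderZmodType).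

Definition iso_invariant (T : Type) (u : A -> T) : Prop :=
  forall (X Y : A) (f : mor X Y), is_iso f -> u X = u Y.

Definition exact_additive (V : nmodType) (u : A -> V) : Prop :=
  forall (M N P : A) (f : mor M N) (g : mor N P),
    short_exact f g -> u N = u M + u P.

Definition rank_function (rk : A -> nat) : Prop :=
  [/\ iso_invariant rk, exact_additive rk
    & forall M : A, ~ is_zero M -> rk M <> 0%N].

Definition degree_function (deg : A -> L) : Prop :=
  iso_invariant deg /\ exact_additive deg.

(* deg M / rk M: the solution y of y *+ rk M = deg M, which is unique when L is
   uniquely divisible and rk M <> 0. The value is only meaningful for nonzero
   M; every use below is guarded accordingly. *)
Definition slope (rk : A -> nat) (deg : A -> L) (M : A) : L :=
  xget 0 [set y : L | y *+ rk M = deg M]%classic.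

Variable mu : A -> L.

Definition slope_function : Prop :=
  forall (M N : A) (phi : mor M N), ~ is_zero M -> ~ is_zero N ->
    is_epi phi -> is_monic phi -> mu M <= mu N /\ (mu M = mu N <-> is_iso phi).

Definition semistable (M : A) : Prop :=
  ~ is_zero M /\
  forall (N : A) (i : mor N M), is_monic i -> ~ is_zero N -> mu N <= mu M.

Definition in_slope_subcat (l : L) (M : A) : Prop :=
  is_zero M \/ (semistable M /\ mu M = l).

End Slopes.

(** * Finite ascending filtrations *)

Section Filtrations.
Variables (A : category) (L : porderZmodType).

Let FunLA : category := Fun (poset_cat L) A.

(* b lists the breaks in increasing order; when it is empty, the first and the
   last clause force the filtration and its colimit to be zero. *)
Definition finite_filtration (F : FunLA) : Prop :=
  exists (M : A) (c : forall l : poset_cat L, mor (F l) M),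
    [/\ is_colim c,
        (forall l, strict (c l) /\ is_monic (c l))
      & exists b : seq L,
          [/\ sorted <%R b,
              (forall l : L, (forall x, x \in b -> l < x) -> is_zero (F l)),
              (forall i : nat, (i.+1 < size b)%N ->
                 forall (l : L) (h : b`_i <= l), l < b`_i.+1 ->
                   is_iso (@fmap _ _ F b`_i l h))
            & (forall l : L, (forall x, x \in b -> x <= l) -> is_iso (c l))]].

Definition Wpre : category := full_subcat finite_filtration.

(* B is W_{<l} = colim_{x < l} W_{<=x} and i the morphism B -> W_{<=l} induced by
   the transition maps. As gr_l is only determined up to isomorphism, is_gr F l G
   says that G is a model of it, and the conditions below range over all models;
   gr_exists at the end shows that there always is one. *)
Definition is_gr (F : FunLA) (l : L) (G : A) : Prop :=
  exists (B : A) (c : forall x, mor (restrict (fun x : poset_cat L => x < l) F x) B)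
         (i : mor B (F l)) (q : mor (F l) G),
    [/\ is_colim c,
        (forall (x : L) (h : x < l),
           i \oc c (exist _ x h) = @fmap _ _ F x l (ltW h))
      & is_coker i q].

Variable mu : A -> L.

Definition in_W (F : Wpre) : Prop :=
  forall (l : L) (G : A), is_gr (sval F) l G -> in_slope_subcat mu l G.

Definition in_uds (F : Wpre) : Prop :=
  forall (l : L) (G : A), is_gr (sval F) l G ->
    forall (N : A) (i : mor N G), is_monic i -> ~ is_zero N -> mu N <= l.

Definition in_udq (F : Wpre) : Prop :=
  forall (l : L) (G : A), is_gr (sval F) l G ->
    forall (N : A) (p : mor G N), is_epi p -> ~ is_zero N -> l <= mu N.

End Filtrations.

Arguments Wpre A L : clear implicits.

Lemma gr_exists (A : category) (hA : quasi_abelian A) (L : porderZmodType)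
  (hL : totally_ordered_group L) (F : Wpre A L) (l : L) :
  exists G : A, is_gr (sval F) l G.
Proof.
case: F => F [M [c [[cc cu] sc [b [sb b0 b1 b2]]]]] /=.
have tot : forall x y : L, (x <= y) || (y < x).
  move=> x y; have := hL.1 x y; case: (boolP (x <= y)) => //= nxy yx.
  rewrite lt_neqAle yx andbT; apply: contra nxy => /eqP ->; exact: lexx.
have [hadd _ hcok _ _] := hA; case: hadd => [_ [_ [_ [_ _ _ [Z hZ] _]]]].
have fc : forall (x y z : L) (p : x <= y) (q : y <= z) (r : x <= z),
    @fmap _ _ F y z q \oc @fmap _ _ F x y p = @fmap _ _ F x z r.
  move=> x y z p q r; rewrite -fmap_comp; congr fmap; exact: bool_irrelevance.
suff [B [t tP]] : exists (B : A)
   (t : forall x, mor (restrict (fun x : poset_cat L => x < l) F x) B), is_colim t.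
  have [|i [iP _]] := tP.2 (F l) (fun x => @fmap _ _ F (sval x) l (ltW (svalP x))).
    by move=> x y a; exact: fc.
  have [Q [q qP]] := hcok _ _ i.
  exists Q, B, t, i, q; split => // x h; rewrite iP /=.
  by congr (@fmap _ _ F x l); exact: bool_irrelevance.
have [[m [mb ml mM]]|nom] := pselect (exists m, [/\ m \in b, m < l &
    forall y, y \in b -> y < l -> y <= m]); last first.
  have nob : forall y, y \in b -> ~~ (y < l).
    move=> y yb; apply/negP => yl; apply: nom.
    have : exists s : seq L, s = [seq z <- b | z < l] by eexists.
    case=> s es; case/lastP: s es => [|s m] es.
      have : y \in [seq z <- b | z < l] by rewrite mem_filter yl.
      by rewrite -es.
    have : m \in [seq z <- b | z < l] by rewrite -es mem_rcons inE eqxx.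
    rewrite mem_filter => /andP[ml mb]; exists m; split => // z zb zl.
    have : z \in rcons s m by rewrite es mem_filter zl.
    rewrite mem_rcons inE => /orP[/eqP -> //|zs].
    have : sorted <%R (rcons s m) by rewrite es sorted_filter//; exact: lt_trans.
    rewrite sorted_pairwise; last exact: lt_trans.
    rewrite pairwise_rcons.
    by case/andP=> /allP /(_ _ zs) /ltW.
  have z0 : forall x : {x : L | x < l}, is_zero (F (sval x)).
    case=> x xl; apply: b0 => y yb; move: (tot l y) (nob y yb).
    by case/orP => [ly _|->//]; exact: lt_le_trans xl ly.
  exists Z, (fun x => projT1 (cid (hZ.1 (F (sval x))))); split.
    move=> x y a /=; have [f [_ fu]] := (z0 x).2 Z.
    exact: etrans (esym (fu _ I)) (fu _ I).
  move=> T t tc; have [u [_ uu]] := hZ.2 T; exists u; split.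
    move=> x; have [f [_ fu]] := (z0 x).2 T.
    exact: etrans (esym (fu _ I)) (fu _ I).
  by move=> *; exact: uu.
have iso_m : forall (x : L) (mx : m <= x), x < l -> is_iso (@fmap _ _ F m x mx).
  move=> x mx xl; set k := index m b.
  have ek : b`_k = m by rewrite nth_index.
  have kb : (k < size b)%N by rewrite index_mem.
  case: (ltnP k.+1 (size b)) => hk.
    have xk : x < b`_k.+1.
      case/orP: (tot l b`_k.+1) => [|h]; first exact: lt_le_trans.
      have := mM _ (mem_nth 0 hk) h; rewrite -{1}ek => h2.
      have : b`_k < b`_k.+1.
        by rewrite (sorted_ltn_nth lt_trans) ?inE.
      by move=> h3; have := lt_le_trans h3 h2; rewrite ltxx.
    by have := b1 k hk x; rewrite ek => /(_ mx xk).
  have big : forall y, y \in b -> y <= m.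
    move=> y yb; rewrite -(nth_index 0 yb) -ek.
    have : (index y b <= k)%N by move: yb; rewrite -index_mem => yb; rewrite -ltnS (leq_trans yb).
    rewrite leq_eqVlt => /orP[/eqP->//|h]; apply: ltW.
    by rewrite (sorted_ltn_nth lt_trans) ?inE// index_mem.
  have [gm [gm1 gm2]] := b2 m big.
  have [gx [gx1 gx2]] := b2 x (fun y yb => le_trans (big y yb) mx).
  have e : c x \oc @fmap _ _ F m x mx = c m by exact: cc.
  exists (gm \oc c x); split; first by rewrite -comp_assoc e.
  by rewrite -[LHS]comp_idl -gx1 -(comp_assoc gx) !comp_assoc -(comp_assoc gx) e -(comp_assoc gx) gm2 comp_idr gx1.
have ub : forall x : L, x < l -> exists y, [/\ x <= y, m <= y & y < l].
  move=> x xl; case/orP: (tot x m) => h; first by exists m.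
  by exists x; rewrite lexx ltW.
have ext : forall x : {x : L | x < l}, exists t : mor (F (sval x)) (F m),
    forall (y : L) (xy : sval x <= y) (my : m <= y), y < l ->
     @fmap _ _ F m y my \oc t = @fmap _ _ F (sval x) y xy.
  case=> x xl /=; case/orP: (tot x m) => h.
    by exists (@fmap _ _ F x m h) => y xy my yl; exact: fc.
  have [g [g1 g2]] := iso_m x (ltW h) xl; exists g => y xy my yl.
  by rewrite -(fc _ _ _ (ltW h) xy my) -comp_assoc g2 comp_idr.
exists (F m), (fun x => projT1 (cid (ext x))).
have tP x := projT2 (cid (ext x)); split.
  move=> x y a; have [z [yz mz zl]] := ub _ (svalP y).
  have [g [g1 g2]] := iso_m z mz zl.
  rewrite -[LHS]comp_idl -[RHS]comp_idl -g1 -!comp_assoc; congr (_ \oc _).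
  rewrite comp_assoc (tP y z yz mz zl) (tP x z (le_trans a yz) mz zl).
  exact: fc.
move=> T t tc; exists (t (exist _ m ml)); split.
  move=> x; have [z [xz mz zl]] := ub _ (svalP x).
  rewrite -(tc (exist _ m ml) (exist _ z zl) mz) -(tc x (exist _ z zl) xz) -comp_assoc.
  congr (_ \oc _); exact: tP.
move=> u hu; rewrite -hu -[RHS]comp_idr; congr (_ \oc _).
have := tP (exist _ m ml) m (lexx m) (lexx m) ml.
have -> : @fmap _ _ F m m (lexx m) = idm _ by exact: fmap_id.
by rewrite comp_idl.
Qed.

(* Main.v *)
(* If M has quotient slopes at least l and N has subobject slopes at most l, then
   a morphism M -> N is strict and its image is zero or of slope l: its coimage
   and image are joined by an epi-monic, along which slopes grow, strictly
   unless it is an isomorphism. Hence every gr_l f is strict, Ker gr_l f has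
   quotient slopes at least l and Coker gr_l f has subobject slopes at most l.
   By induction on l, Coker f_{<l} has subobject slopes less than l, so the snake
   morphism Ker gr_l f -> Coker f_{<l} is zero. It follows that f_l is strict, that
   Coker f_{<l} -> Coker f_l is a strict monic with cokernel Coker gr_l f, and
   that gr_l (Ker f) = Ker gr_l f. So the pointwise cokernel and kernel are finite
   filtrations with the required graded pieces. *)
Require Import Defs.
From mathcomp Require Import all_boot all_order all_algebra.
From mathcomp Require Import boolp classical_sets.

Set Implicit Arguments.
Unset Strict Implicit.
Unset Printing Implicit Defensive.

Import Order.TTheory GRing.Theory Num.Theory.

(** * Additive and quasi-abelian categories *)

(** The obstacle is that in a quasi-abelian category the morphism from coimage to image is only
    epi-monic. The snake lemma is therefore available for strict morphisms only, and strictness of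
    f_l cannot be separated from the slope bound on Coker f_{<l}: the two go through a single
    induction. Transition maps of a pointwise kernel are always strict monics, whereas those of a
    pointwise cokernel need not even be monic; the vanishing of the snake morphism is what makes
    them strict monics. Objects have no elements, but strict epis are stable under pullback. Chases
    are therefore run on generalized elements T -> X, where T is replaced by the source of a strict
    epi onto it whenever a lift is required. Dual chases are the same lemmas applied in [op C].
    Ascending filtrations and slope inequalities are not dualized; kernels and cokernels are both
    read off from the same strictness statement. *)

Definition op (C : category) : category :=
  @Category (obj C) (fun X Y => mor Y X) (fun X => idm X)
    (fun _ _ _ g f => f \oc g) (fun _ _ f => comp_idr f)
    (fun _ _ f => comp_idl f) (fun _ _ _ _ h g f => esym (comp_assoc f g h)).

(* additive_cat with its operations as data, so that a category and its opposite
   share them and every statement can be dualized. *)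
Record additive_str (C : category) := Additive {
  zr : forall X Y : C, mor X Y;
  ad : forall X Y : C, mor X Y -> mor X Y -> mor X Y;
  ng : forall X Y : C, mor X Y -> mor X Y;
  adA : forall X Y : C, associative (@ad X Y);
  adC : forall X Y : C, commutative (@ad X Y);
  ad0m : forall X Y : C, left_id (zr X Y) (@ad X Y);
  adNm : forall X Y : C, left_inverse (zr X Y) (@ng X Y) (@ad X Y);
  compDr : forall (X Y Z : C) (h : mor Y Z) (f g : mor X Y),
    h \oc ad f g = ad (h \oc f) (h \oc g);
  compDl : forall (X Y Z : C) (f g : mor Y Z) (h : mor X Y),
    ad f g \oc h = ad (f \oc h) (g \oc h);
  null_object : exists Z : C, is_zero Z;
  biproduct : forall X Y : C, exists (B : C) (i : mor X B) (j : mor Y B)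
      (p : mor B X) (q : mor B Y),
    [/\ p \oc i = idm X, q \oc j = idm Y, p \oc j = zr Y X, q \oc i = zr X Y
      & ad (i \oc p) (j \oc q) = idm B] }.

Arguments zr {C} _ {X Y}.
Arguments ad {C} _ {X Y}.
Arguments ng {C} _ {X Y}.

Lemma op_zero (C : category) (Z : C) : is_zero Z -> @is_zero (op C) Z.
Proof. by case. Qed.

Program Definition op_additive (C : category) (S : additive_str C) : additive_str (op C) :=
  @Additive (op C) (fun X Y => @zr C S Y X) (fun X Y => @ad C S Y X)
    (fun X Y => @ng C S Y X) _ _ _ _ _ _ _ _.
Next Obligation. by move=> *; apply: adA. Qed.
Next Obligation. by move=> *; apply: adC. Qed.
Next Obligation. by move=> *; apply: ad0m. Qed.
Next Obligation. by move=> *; apply: adNm. Qed.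
Next Obligation. by apply: compDl. Qed.
Next Obligation. by apply: compDr. Qed.
Next Obligation. by have [Z /op_zero hZ] := null_object S; exists Z. Qed.
Next Obligation.
have [B [i [j [p [q [pi qj pj qi e]]]]]] := @biproduct C S X Y.
by exists B, p, q, i, j.
Qed.

Section Additive.
Variables (C : category) (S : additive_str C).
Implicit Types X Y Z T : C.

(** With vanishing written as an equation and uniqueness of factorizations as monicity, [ker0] in
    [op C] unfolds to [coker0] in C, so that dual statements hold by conversion. *)
Definition ker0 X Y (f : mor X Y) K (k : mor K X) : Prop :=
  [/\ f \oc k = zr S, is_monic k
    & forall T (h : mor T X), f \oc h = zr S -> exists u, k \oc u = h].

Definition coker0 X Y (f : mor X Y) Q (q : mor Y Q) : Prop :=
  [/\ q \oc f = zr S, is_epi q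
    & forall T (h : mor Y T), h \oc f = zr S -> exists u, u \oc q = h].

Definition smono X Y (m : mor X Y) : Prop := exists Z (g : mor Y Z), ker0 g m.
Definition sepi X Y (e : mor X Y) : Prop := exists Z (k : mor Z X), coker0 k e.

Definition ses X Y Z (i : mor X Y) (p : mor Y Z) : Prop := ker0 p i /\ coker0 i p.

Lemma adm0 X Y (f : mor X Y) : ad S f (zr S) = f.
Proof. by rewrite adC ad0m. Qed.

Lemma admN X Y (f : mor X Y) : ad S f (ng S f) = zr S.
Proof. by rewrite adC adNm. Qed.

Lemma ad_idem0 X Y (f : mor X Y) : ad S f f = f -> f = zr S.
Proof. by move=> e; rewrite -(adNm S f) -{3}e adA adNm ad0m. Qed.

Lemma comp0r X Y Z (f : mor Y Z) : f \oc (zr S : mor X Y) = zr S.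
Proof. by apply: ad_idem0; rewrite -compDr ad0m. Qed.

Lemma comp0l X Y Z (f : mor X Y) : (zr S : mor Y Z) \oc f = zr S.
Proof. by apply: ad_idem0; rewrite -compDl ad0m. Qed.

Lemma ad_ng_eq X Y (f g : mor X Y) : ad S f (ng S g) = zr S -> f = g.
Proof. by move=> e; rewrite -(ad0m S g) -e -adA adNm adm0. Qed.

Lemma ng_unique X Y (f g : mor X Y) : ad S f g = zr S -> f = ng S g.
Proof. by move=> e; rewrite -(adm0 f) -(admN g) adA e ad0m. Qed.

Lemma ng0 X Y : ng S (zr S : mor X Y) = zr S.
Proof. by rewrite -(ng_unique (ad0m S (zr S))). Qed.

Lemma compNr X Y Z (f : mor Y Z) (g : mor X Y) : f \oc ng S g = ng S (f \oc g).
Proof. by apply: ng_unique; rewrite -compDr adNm comp0r. Qed.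

Lemma compNl X Y Z (f : mor Y Z) (g : mor X Y) : ng S f \oc g = ng S (f \oc g).
Proof. by apply: ng_unique; rewrite -compDl adNm comp0l. Qed.

Lemma sub_swap X Y (f g h : mor X Y) : ad S f (ng S g) = h -> f = ad S g h.
Proof. by move=> <-; rewrite adC -adA adNm adm0. Qed.

Lemma monic0 X Y (m : mor X Y) T (u : mor T X) : is_monic m -> m \oc u = zr S -> u = zr S.
Proof. by move=> mm e; apply: mm; rewrite e comp0r. Qed.

Lemma epi0 X Y (e : mor X Y) T (u : mor Y T) : is_epi e -> u \oc e = zr S -> u = zr S.
Proof. by move=> ee h; apply: ee; rewrite h comp0l. Qed.

Lemma monic_of0 X Y (m : mor X Y) :
  (forall T (u : mor T X), m \oc u = zr S -> u = zr S) -> is_monic m.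
Proof.
move=> h T u v e; apply: ad_ng_eq; apply: h.
by rewrite compDr compNr e admN.
Qed.

Lemma zeroP Z : is_zero Z <-> idm Z = zr S.
Proof.
split=> [[h _]|e]; first by have [f [_ u]] := h Z; rewrite -(u (idm Z)) // -(u (zr S)).
split=> X; exists (zr S); split=> // f _.
  by rewrite -(comp_idl f) e comp0l.
by rewrite -(comp_idr f) e comp0r.
Qed.

Lemma zero_src Z X (f : mor Z X) : is_zero Z -> f = zr S.
Proof. by move=> /zeroP e; rewrite -(comp_idr f) e comp0r. Qed.

Lemma zero_tgt Z X (f : mor X Z) : is_zero Z -> f = zr S.
Proof. by move=> /zeroP e; rewrite -(comp_idl f) e comp0l. Qed.

Lemma zero_morE X Y (f : mor X Y) : zero_mor f <-> f = zr S.
Proof.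
split=> [[Z [v [u [hZ ->]]]]|->].
  by rewrite (zero_src v hZ) comp0l.
have [Z hZ] := null_object S.
by exists Z, (zr S), (zr S); rewrite comp0l.
Qed.

Lemma is_kerE X Y (f : mor X Y) K (k : mor K X) : is_ker f k <-> ker0 f k.
Proof.
split=> [[/zero_morE f0 fu]|[f0 mk fu]].
  split=> // [T u v e|T h /zero_morE /fu [u [e _]]]; last by exists u.
  have /zero_morE/fu[w [_ uw]] : f \oc (k \oc v) = zr S by rewrite comp_assoc f0 comp0l.
  by rewrite -(uw v erefl) -(uw u e).
split; first exact/zero_morE.
move=> T h /zero_morE /fu [u e]; exists u; split=> // v; rewrite -e.
by move/mk.
Qed.

Lemma is_cokerE X Y (f : mor X Y) K (k : mor Y K) : is_coker f k <-> coker0 f k.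
Proof.
split=> [[/zero_morE f0 fu]|[f0 mk fu]].
  split=> // [T u v e|T h /zero_morE /fu [u [e _]]]; last by exists u.
  have /zero_morE/fu[w [_ uw]] : (v \oc k) \oc f = zr S by rewrite -comp_assoc f0 comp0r.
  by rewrite -(uw v erefl) -(uw u e).
split; first exact/zero_morE.
move=> T h /zero_morE /fu [u e]; exists u; split=> // v; rewrite -e.
by move/mk.
Qed.

Lemma smonoE X Y (m : mor X Y) : is_kernel m <-> smono m.
Proof. by split=> -[Z [g /is_kerE h]]; exists Z, g. Qed.

Lemma sepiE X Y (m : mor X Y) : is_cokernel m <-> sepi m.
Proof. by split=> -[Z [g /is_cokerE h]]; exists Z, g. Qed.

Lemma short_exactE X Y Z (i : mor X Y) (p : mor Y Z) : short_exact i p <-> ses i p.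
Proof.
by split=> -[/is_kerE h /is_cokerE k]; split.
Qed.

Lemma smono_monic X Y (m : mor X Y) : smono m -> is_monic m.
Proof. by case=> Z [g []]. Qed.

Lemma sepi_epi X Y (m : mor X Y) : sepi m -> is_epi m.
Proof. by case=> Z [g []]. Qed.

Lemma smono_ker X Y (m : mor X Y) Q (q : mor Y Q) : smono m -> coker0 m q -> ker0 q m.
Proof.
case=> Z [g [g0 mm gu]] [q0 eq qu]; split=> // T h qh; apply: gu.
by have [u <-] := qu _ _ g0; rewrite -comp_assoc qh comp0r.
Qed.

Lemma ker_iso X Y (f : mor X Y) K (k : mor K X) K' (t : mor K' K) :
  ker0 f k -> is_iso t -> ker0 f (k \oc t).
Proof.
move=> [k0 mk ku] [s [st ts]]; split; first by rewrite comp_assoc k0 comp0l.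
  move=> T u v; rewrite -!comp_assoc => /mk e.
  by rewrite -(comp_idl u) -(comp_idl v) -st -!comp_assoc e.
move=> T h /ku [u <-]; exists (s \oc u).
by rewrite -comp_assoc [t \oc _]comp_assoc ts comp_idl.
Qed.

Lemma ker_unique X Y (f : mor X Y) K (k : mor K X) K' (k' : mor K' X) :
  ker0 f k -> ker0 f k' -> exists t : mor K K', is_iso t /\ k' \oc t = k.
Proof.
move=> [k0 mk ku] [k0' mk' ku'].
have [t e] := ku' _ _ k0; have [s e'] := ku _ _ k0'.
exists t; split=> //; exists s; split.
  by apply: mk; rewrite comp_assoc e' e comp_idr.
by apply: mk'; rewrite comp_assoc e e' comp_idr.
Qed.

Lemma iso_monic X Y (f : mor X Y) : is_iso f -> is_monic f.
Proof.
move=> [g [gf _]] T u v e.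
by rewrite -(comp_idl u) -(comp_idl v) -gf -!comp_assoc e.
Qed.

Lemma iso_smono X Y (f : mor X Y) : is_iso f -> smono f.
Proof.
move=> fi; exists Y, (zr S); split; [by rewrite comp0l|exact: iso_monic|].
move=> T h _; have [g [gf fg]] := fi; exists (g \oc h).
by rewrite comp_assoc fg comp_idl.
Qed.

Lemma monic_sepi_iso X Y (f : mor X Y) : is_monic f -> sepi f -> is_iso f.
Proof.
move=> mf [Z [k [k0 ef fu]]].
have [g gf] : exists u, u \oc f = idm X.
  by apply: fu; rewrite comp_idl; apply: (monic0 mf).
exists g; split=> //; apply: ef.
by rewrite -comp_assoc gf comp_idr comp_idl.
Qed.

Lemma zero_smono Z X (f : mor Z X) : is_zero Z -> smono f.
Proof.
move=> hZ; exists X, (idm X); split; first by rewrite comp_idl; exact: zero_src.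
  by move=> T u v _; rewrite (zero_tgt u hZ) (zero_tgt v hZ).
move=> T h; rewrite comp_idl => ->; exists (zr S); exact: comp0r.
Qed.

Lemma zero_iso X Y (f : mor X Y) : is_zero X -> is_zero Y -> is_iso f.
Proof.
move=> hX hY; exists (zr S); rewrite comp0l comp0r.
by move/zeroP: hX; move/zeroP: hY.
Qed.

Lemma monic_zero X Y (f : mor X Y) : is_monic f -> is_zero Y -> is_zero X.
Proof.
move=> mf hY; apply/zeroP; apply: (monic0 mf); exact: zero_tgt.
Qed.

Lemma epi_zero X Y (f : mor X Y) : is_epi f -> is_zero X -> is_zero Y.
Proof.
move=> mf hY; apply/zeroP; apply: (epi0 mf); exact: zero_src.
Qed.

Lemma smono_ext X Y Z (f : mor X Y) (t : mor Z X) : smono f -> is_iso t -> smono (f \oc t).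
Proof. by move=> [W [g h]] ti; exists W, g; apply: ker_iso. Qed.

(** If p is the cokernel of some w, then w factors through the kernel i, so a morphism that kills i
    also kills w. *)
Lemma ker_ses X Y Z (i : mor X Y) (p : mor Y Z) : ker0 p i -> sepi p -> ses i p.
Proof.
move=> ki [W [w [w0 ep pu]]]; split=> //; have [i0 mi iu] := ki; split=> // T h hi.
by apply: pu; have [u <-] := iu _ _ w0; rewrite comp_assoc hi comp0l.
Qed.

End Additive.

Lemma coker_ses (C : category) (S : additive_str C) (X Y Z : C) (i : mor X Y) (p : mor Y Z) :
  coker0 S i p -> smono S i -> ses S i p.
Proof.
by move=> h m; have [] := @ker_ses (op C) (op_additive S) Z Y X p i h m.
Qed.

Lemma coker_iso (C : category) (S : additive_str C) (X Y : C) (f : mor X Y)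
    Q (q : mor Y Q) Q' (t : mor Q Q') :
  coker0 S f q -> is_iso t -> coker0 S f (t \oc q).
Proof.
move=> h [g [gt tg]].
by apply: (@ker_iso (op C) (op_additive S) Y X f Q q Q' t h); exists g.
Qed.

Lemma coker_unique (C : category) (S : additive_str C) (X Y : C) (f : mor X Y)
    Q (q : mor Y Q) Q' (q' : mor Y Q') :
  coker0 S f q -> coker0 S f q' -> exists t : mor Q Q', is_iso t /\ t \oc q = q'.
Proof.
move=> h h'.
have [t [[g [gt tg]] tE]] := @ker_unique (op C) (op_additive S) Y X f Q' q' Q q h' h.
by exists t; split=> //; exists g.
Qed.

Record qab (C : category) := Qab {
  qadd :> additive_str C;
  has_ker : forall (X Y : C) (f : mor X Y), exists K (k : mor K X), ker0 qadd f k;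
  has_coker : forall (X Y : C) (f : mor X Y), exists Q (q : mor Y Q), coker0 qadd f q;
  pushout_smono : forall (X Y Z P : C) (f : mor X Y) (g : mor X Z)
    (f' : mor Z P) (g' : mor Y P), is_pushout f g f' g' -> smono qadd f -> smono qadd f';
  pullback_sepi : forall (X Y Z P : C) (f : mor Y X) (g : mor Z X)
    (f' : mor P Z) (g' : mor P Y), is_pullback f g f' g' -> sepi qadd f -> sepi qadd f' }.

Definition op_qab (C : category) (S : qab C) : qab (op C) :=
  @Qab (op C) (op_additive S)
    (fun X Y f => @has_coker C S Y X f) (fun X Y f => @has_ker C S Y X f)
    (fun _ _ _ _ f g f' g' h => @pullback_sepi C S _ _ _ _ f g f' g' h)
    (fun _ _ _ _ f g f' g' h => @pushout_smono C S _ _ _ _ f g f' g' h).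

Lemma qab_of (C : category) : quasi_abelian C -> exists S : qab C, True.
Proof.
case=> -[add [zero [opp [g1 dr dl hz bp]]]] hk hc po pb.
have a1 X Y : associative (@add X Y) by case: (g1 X Y).
have a2 X Y : commutative (@add X Y) by case: (g1 X Y).
have a3 X Y : left_id (zero X Y) (@add X Y) by case: (g1 X Y).
have a4 X Y : left_inverse (zero X Y) (@opp X Y) (@add X Y) by case: (g1 X Y).
pose S := @Additive C zero add opp a1 a2 a3 a4 dr dl hz bp.
unshelve eexists (@Qab C S _ _ _ _) => //.
- by move=> X Y f; have [K [k /(is_kerE S) h]] := hk _ _ f; exists K, k.
- by move=> X Y f; have [K [k /(is_cokerE S) h]] := hc _ _ f; exists K, k.
- move=> X Y Z P f g f' g' h /smonoE m; apply/smonoE; exact: po h m.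
- move=> X Y Z P f g f' g' h /sepiE m; apply/sepiE; exact: pb h m.
Qed.

(** * Strict epis as covers for diagram chases *)

Section Covers.
Variables (C : category) (S : qab C).
Implicit Types X Y Z T : C.

(** The kernel of f p - g q on the biproduct of Y and Z. *)
Lemma pullback_exists X Y Z (f : mor Y X) (g : mor Z X) :
  exists P (f' : mor P Z) (g' : mor P Y), is_pullback f g f' g'.
Proof.
have [B [i [j [p [q [pi qj pj qi e]]]]]] := biproduct S Y Z.
have [P [k [k0 mk ku]]] := has_ker S (ad S (f \oc p) (ng S (g \oc q))).
exists P, (q \oc k), (p \oc k); split.
  apply: (ad_ng_eq (S := S)).
  by rewrite !comp_assoc -compNl -compDl.
move=> T a b ab.
have [u uE] : exists u, k \oc u = ad S (i \oc a) (j \oc b).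
  apply: ku; rewrite compDl !compNl !compDr !comp_assoc -!(comp_assoc f) -!(comp_assoc g).
  by rewrite pi qj pj qi !comp_idl !comp0l !comp0r adm0 ad0m ab admN.
have pu : p \oc (k \oc u) = a.
  by rewrite uE compDr !comp_assoc pi pj comp_idl comp0l adm0.
have qu : q \oc (k \oc u) = b.
  by rewrite uE compDr !comp_assoc qi qj comp_idl comp0l ad0m.
exists u; split=> [|v []]; rewrite -!comp_assoc // => va vb.
apply: mk; rewrite -(comp_idl (k \oc u)) -(comp_idl (k \oc v)) -e !compDl -!comp_assoc.
by rewrite pu qu va vb.
Qed.

(** Basic move of every chase: a generalized element of Y lifts along a strict epi after passing to
    a cover p of its domain. *)
Lemma sepi_lift X Y T (e : mor X Y) (y : mor T Y) : sepi S e ->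
  exists T' (p : mor T' T) (x : mor T' X), sepi S p /\ e \oc x = y \oc p.
Proof.
move=> he; have [P [p [x h]]] := pullback_exists e y.
exists P, p, x; split; [exact: pullback_sepi h he|exact: h.1].
Qed.

(** Surjectivity test that ends the chases. If t kills Ker g, then t x kills Ker p and descends
    along p to u. The equation u g = t is checked on the cover r of X obtained by pulling p back
    along g: there r and x y differ by an element of Ker g. *)
Lemma sepi_of_lift X Y T (g : mor X Y) (p : mor T Y) (x : mor T X) :
  sepi S p -> g \oc x = p -> sepi S g.
Proof.
move=> hp gx; have [K [k [k0 mk ku]]] := has_ker S g.
have ep := sepi_epi hp.
have eg : is_epi g.
  by move=> U u v e; apply: ep; rewrite -gx !comp_assoc e.
exists K, k; split=> // U t tk.
have [W [w [w0 _ wu]]] := hp.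
have [v vE] : exists v, k \oc v = x \oc w by apply: ku; rewrite comp_assoc gx w0.
have [u uE] : exists u, u \oc p = t \oc x.
  by apply: wu; rewrite -comp_assoc -vE comp_assoc tk comp0l.
exists u.
have [P [r [y [sr yE]]]] := sepi_lift g hp.
have [c cE] : exists c, k \oc c = ad S r (ng S (x \oc y)).
  by apply: ku; rewrite compDr compNr comp_assoc gx yE admN.
apply: (sepi_epi sr); rewrite (sub_swap (esym cE)) !compDr; congr (ad S _ _).
  by rewrite !comp_assoc -uE -gx !comp_assoc.
by rewrite !comp_assoc tk -(comp_assoc u g) k0 comp0r !comp0l.
Qed.

(** A morphism t that kills Ker (g f) descends along f to t1. That t1 kills w', of which g is the
    cokernel, is checked on a cover where w' lifts along f: the lift lies in Ker (g f). *)
Lemma sepi_comp X Y Z (f : mor X Y) (g : mor Y Z) :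
  sepi S f -> sepi S g -> sepi S (g \oc f).
Proof.
move=> sf sg; have [K [k [k0 mk ku]]] := has_ker S (g \oc f).
have ef := sepi_epi sf; have eg := sepi_epi sg.
exists K, k; split=> //.
  by move=> U u v; rewrite !comp_assoc => /ef /eg.
move=> U t tk; have [W [w [w0 _ wu]]] := sf.
have [v vE] : exists v, k \oc v = w by apply: ku; rewrite -comp_assoc w0 comp0r.
have [t1 t1E] : exists u, u \oc f = t by apply: wu; rewrite -vE comp_assoc tk comp0l.
have [W' [w' [w0' _ wu']]] := sg.
have [u uE] : exists u, u \oc g = t1.
  apply: wu'; have [P [p [x [sp xE]]]] := sepi_lift w' sf.
  apply: (epi0 (S := S) (sepi_epi sp)); rewrite -comp_assoc -xE comp_assoc t1E.
  have [y <-] : exists y, k \oc y = x.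
    by apply: ku; rewrite -comp_assoc xE comp_assoc w0' comp0l.
  by rewrite comp_assoc tk comp0l.
by exists u; rewrite comp_assoc uE.
Qed.

End Covers.

Section StrictMonics.
Variables (C : category) (S : qab C).
Implicit Types X Y Z T : C.

Lemma smono_comp X Y Z (f : mor X Y) (g : mor Y Z) :
  smono S f -> smono S g -> smono S (g \oc f).
Proof. by move=> sf sg; apply: (@sepi_comp (op C) (op_qab S) Z Y X g f). Qed.

Lemma smono_cancel X Y Z (f : mor X Y) (g : mor Y Z) :
  smono S (g \oc f) -> smono S f.
Proof. by move=> h; apply: (@sepi_of_lift (op C) (op_qab S) Y X Z f (g \oc f) g). Qed.

(** An element of the coimage killed by m lifts, on a cover, to an element of Ker f, and e kills Ker
    f. *)
Lemma coim_fac X Y (f : mor X Y) K (k : mor K X) I (e : mor X I) :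
  ker0 S f k -> coker0 S k e -> exists m, m \oc e = f /\ is_monic m.
Proof.
move=> [k0 mk ku] he; have [e0 ee eu] := he.
have [m mE] := eu _ _ k0; exists m; split=> //; apply: (monic_of0 (S := S)) => T x mx.
have [P [p [y [sp yE]]]] := sepi_lift x (ex_intro _ K (ex_intro _ k he)).
apply: (epi0 (S := S) (sepi_epi sp)); rewrite -yE.
have [v <-] : exists v, k \oc v = y.
  by apply: ku; rewrite -mE -comp_assoc yE comp_assoc mx comp0l.
by rewrite comp_assoc e0 comp0l.
Qed.

End StrictMonics.

(** * Strict morphisms and the snake lemma *)

Lemma im_fac (C : category) (S : qab C) (X Y : C) (f : mor X Y)
    Q (q : mor Y Q) J (j : mor J Y) :
  coker0 S f q -> ker0 S q j -> exists w, j \oc w = f /\ is_epi w.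
Proof. exact: (@coim_fac (op C) (op_qab S)). Qed.

Section Strict.
Variables (C : category) (S : qab C).
Implicit Types X Y Z T : C.

(* Equivalent to strict in a quasi-abelian category, but visibly self-dual. *)
Definition sfac X Y (f : mor X Y) : Prop :=
  exists I (e : mor X I) (m : mor I Y), [/\ sepi S e, smono S m & m \oc e = f].

Lemma sfac_coker X Y (f : mor X Y) I (e : mor X I) (m : mor I Y) Q (q : mor Y Q) :
  is_epi e -> m \oc e = f -> coker0 S f q -> coker0 S m q.
Proof.
move=> ee <- [q0 eq qu]; split=> //.
  by apply: (epi0 (S := S) ee); rewrite -comp_assoc.
by move=> T h hm; apply: qu; rewrite comp_assoc hm comp0l.
Qed.

(** Strictness enters the chases here: Ker q is m, and e is a strict epi onto its source. For a
    general f the image Ker q may differ from the coimage, and such lifts can fail. *)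
Lemma sfac_lift X Y (f : mor X Y) Q (q : mor Y Q) T (y : mor T Y) :
  sfac f -> coker0 S f q -> q \oc y = zr S ->
  exists T' (p : mor T' T) x, sepi S p /\ f \oc x = y \oc p.
Proof.
move=> [I [e [m [se sm me]]]] hq qy.
have [_ _ mu] := smono_ker sm (sfac_coker (sepi_epi se) me hq).
have [u uE] := mu _ _ qy.
have [T' [p [x [sp xE]]]] := sepi_lift u se.
by exists T', p, x; split=> //; rewrite -me -comp_assoc xE comp_assoc uE.
Qed.

(** Provides the epi-monic to which the slope axiom applies: u is monic because j u is the monic of
    [coim_fac], and epi because u e is the epi of [im_fac]. *)
Lemma coim_im X Y (f : mor X Y) : exists I (e : mor X I) J (j : mor J Y) (u : mor I J),
  [/\ sepi S e, smono S j, j \oc u \oc e = f, is_monic u & is_epi u].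
Proof.
have [K [k hk]] := has_ker S f; have [I [e he]] := has_coker S k.
have [m [me mm]] := coim_fac hk he.
have [Q [q hq]] := has_coker S f; have [J [j hj]] := has_ker S q.
have [w [jw ew]] := im_fac hq hj.
have [u uE] : exists u, j \oc u = m.
  case: hj => _ _; apply; case: he => _ ee _; apply: (epi0 (S := S) ee).
  by rewrite -comp_assoc me; case: hq.
exists I, e, J, j, u; split.
- by exists K, k.
- by exists Q, q.
- by rewrite uE.
- by move=> T a b ab; apply: mm; rewrite -uE -!comp_assoc ab.
- have uw : u \oc e = w by case: hj => _ mj _; apply: mj; rewrite jw comp_assoc uE.
  by move=> T a b ab; apply: ew; rewrite -uw !comp_assoc ab.
Qed.

(** A subobject of an extension is itself an extension: take the kernel and the coimage of b x, the
    latter embedding into X2 by [coim_fac]. *)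
Lemma ses_lift_monic X0 X1 X2 (a : mor X0 X1) (b : mor X1 X2) X (x : mor X X1) :
  ses S a b -> is_monic x ->
  exists Y0 Y2 (i : mor Y0 X) (p : mor X Y2) (x0 : mor Y0 X0) (x2 : mor Y2 X2),
    [/\ ses S i p, is_monic x0 & is_monic x2].
Proof.
move=> [[_ _ au] _] mx.
have [Y0 [i hi]] := has_ker S (b \oc x); have [Y2 [p hp]] := has_coker S i.
have [x2 [_ mx2]] := coim_fac hi hp.
have [x0 x0E] : exists s, a \oc s = x \oc i by apply: au; rewrite comp_assoc; case: hi.
exists Y0, Y2, i, p, x0, x2; split=> //.
  by apply: coker_ses => //; exists X2, (b \oc x).
case: hi => _ mi _ T u v uv; apply: mi; apply: mx.
by rewrite !comp_assoc -x0E -!comp_assoc uv.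
Qed.

(** X' is the preimage of the subobject X under p; it contains J with quotient X. *)
Lemma pullback_ses J H Q (j : mor J H) (p : mor H Q) X (x : mor X Q) :
  ses S j p -> is_monic x ->
  exists X' (y : mor X' H) (j' : mor J X') (p' : mor X' X), is_monic y /\ ses S j' p'.
Proof.
move=> [[j0 mj ju] cj] mx.
have [P [p' [y [pb pu]]]] := pullback_exists S p x.
have my : is_monic y.
  move=> T u v e; have e' : p' \oc u = p' \oc v.
    by apply: mx; rewrite !comp_assoc -pb -!comp_assoc e.
  have [w [_ wu]] : exists! w, y \oc w = y \oc u /\ p' \oc w = p' \oc u.
    by apply: pu; rewrite !comp_assoc pb.
  by rewrite -(wu u) // -(wu v).
have [j' [[yj pj] _]] : exists! w, y \oc w = j /\ p' \oc w = zr S.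
  by apply: pu; rewrite comp0r.
exists P, y, j', p'; split=> //.
apply: ker_ses; last by apply: (pullback_sepi (conj pb pu)); exists J, j.
split=> // [T u v e|T h ph].
  by apply: mj; rewrite -yj -!comp_assoc e.
have [t tE] : exists t, j \oc t = y \oc h.
  by apply: ju; rewrite comp_assoc pb -comp_assoc ph comp0r.
by exists t; apply: my; rewrite comp_assoc yj.
Qed.

End Strict.

Lemma ses_op (C : category) (S : additive_str C) (X Y Z : C) (i : mor X Y) (p : mor Y Z) :
  ses S i p -> @ses (op C) (op_additive S) Z Y X p i.
Proof. by case. Qed.

Lemma sfac_op (C : category) (S : qab C) (X Y : C) (f : mor X Y) :
  sfac S f -> @sfac (op C) (op_qab S) Y X f.
Proof. by case=> I [e [m [se sm me]]]; exists I, m, e. Qed.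

Lemma pushout_ses (C : category) (S : qab C) (K G I X : C)
    (k : mor K G) (e : mor G I) (x : mor K X) :
  ses S k e -> is_epi x ->
  exists X' (y : mor G X') (e' : mor X' I) (k' : mor X X'), is_epi y /\ ses S k' e'.
Proof.
move=> s ex; have [X' [y [e' [k' [ey se]]]]] :=
  @pullback_ses (op C) (op_qab S) I G K e k X x (ses_op s) ex.
by exists X', y, e', k'; split=> //; case: se.
Qed.

Section KernelSequence.
Variables (C : category) (S : qab C) (A1 A2 A3 B1 B2 B3 : C).
Variables (j : mor A1 A2) (r : mor A2 A3) (j' : mor B1 B2) (r' : mor B2 B3).
Variables (f1 : mor A1 B1) (f2 : mor A2 B2) (f3 : mor A3 B3).
Hypotheses (sA : ses S j r) (sB : ses S j' r').
Hypotheses (e1 : f2 \oc j = j' \oc f1) (e2 : f3 \oc r = r' \oc f2).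
Variables (K2 K3 : C) (k2 : mor K2 A2) (k3 : mor K3 A3) (v : mor K2 K3).
Hypotheses (hk2 : ker0 S f2 k2) (hk3 : ker0 S f3 k3).
Hypothesis vE : k3 \oc v = r \oc k2.

Lemma ker_left_exact K1 (k1 : mor K1 A1) (w : mor K1 K2) :
  ker0 S f1 k1 -> k2 \oc w = j \oc k1 -> ker0 S v w.
Proof.
move=> [k10 mk1 k1u] wE; have [k20 mk2 k2u] := hk2; have [k30 mk3 k3u] := hk3.
have [[j0 mj ju] _] := sA; have [[_ mj' _] _] := sB; split.
- apply: (monic0 (S := S) mk3).
  by rewrite comp_assoc vE -comp_assoc wE comp_assoc j0 comp0l.
- move=> T a b ab; apply: mk1; apply: mj.
  by rewrite !comp_assoc -wE -!comp_assoc ab.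
- move=> T h vh.
  have [a aE] : exists a, j \oc a = k2 \oc h.
    by apply: ju; rewrite comp_assoc -vE -comp_assoc vh comp0r.
  have [u uE] : exists u, k1 \oc u = a.
    apply: k1u; apply: (monic0 (S := S) mj').
    by rewrite comp_assoc -e1 -comp_assoc aE comp_assoc k20 comp0l.
  exists u; apply: mk2.
  by rewrite comp_assoc wE -comp_assoc uE.
Qed.

(* By the snake lemma the obstruction to surjectivity of v is a morphism from
   Ker f3 to Coker f1. *)
Lemma ker_right_exact Q1 (q1 : mor B1 Q1) :
  coker0 S f1 q1 -> sfac S f1 -> (forall d : mor K3 Q1, d = zr S) -> sepi S v.
Proof.
move=> hq1 sf1 van; have [k20 mk2 k2u] := hk2; have [k30 mk3 k3u] := hk3.
have [[j0 mj ju] hr] := sA; have [[_ mj' ju'] _] := sB.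
have [T [p [a2 [sp a2E]]]] := sepi_lift k3 (ex_intro _ A1 (ex_intro _ j hr)).
have [b1 b1E] : exists b, j' \oc b = f2 \oc a2.
  apply: ju'; rewrite comp_assoc -e2 -comp_assoc a2E comp_assoc k30.
  by rewrite comp0l.
(* On w, of which p is the cokernel, a2 comes from A1 and hence b1 from f1. So q1 b1 descends along
   p to a morphism from K3 to Q1, which is the snake morphism. *)
have q1b1 : q1 \oc b1 = zr S.
  have [W [w [w0 ep wu]]] := sp.
  have [a1 a1E] : exists a, j \oc a = a2 \oc w.
    by apply: ju; rewrite comp_assoc a2E -comp_assoc w0 comp0r.
  have [d <-] : exists d, d \oc p = q1 \oc b1.
    apply: wu; have -> : q1 \oc b1 \oc w = q1 \oc f1 \oc a1.
      rewrite -!comp_assoc; congr (_ \oc _); apply: mj'.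
      by rewrite !comp_assoc b1E -e1 -!comp_assoc a1E.
    by case: hq1 => -> _ _; rewrite comp0l.
  by rewrite (van d) comp0l.
have [T' [p' [a1 [sp' a1E]]]] := sfac_lift sf1 hq1 q1b1.
(* Subtracting j a1 corrects the lift a2 to an element of Ker f2 without changing its image in
   A3. *)
have [x xE] : exists x, k2 \oc x = ad S (a2 \oc p') (ng S (j \oc a1)).
  apply: k2u; rewrite compDr compNr !comp_assoc e1 -b1E.
  by rewrite -!(comp_assoc j') a1E admN.
apply: (@sepi_of_lift _ _ _ _ _ v (p \oc p') x); first exact: sepi_comp.
apply: mk3; rewrite comp_assoc vE -comp_assoc xE compDr compNr !comp_assoc a2E j0.
by rewrite comp0l ng0 adm0.
Qed.

End KernelSequence.

Section CokernelSequence.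
Variables (C : category) (S : qab C) (A1 A2 A3 B1 B2 B3 : C).
Variables (j : mor A1 A2) (r : mor A2 A3) (j' : mor B1 B2) (r' : mor B2 B3).
Variables (f1 : mor A1 B1) (f2 : mor A2 B2) (f3 : mor A3 B3).
Hypotheses (sA : ses S j r) (sB : ses S j' r').
Hypotheses (e1 : f2 \oc j = j' \oc f1) (e2 : f3 \oc r = r' \oc f2).
Variables (Q1 Q2 : C) (q1 : mor B1 Q1) (q2 : mor B2 Q2) (v : mor Q1 Q2).
Hypotheses (hq1 : coker0 S f1 q1) (hq2 : coker0 S f2 q2).
Hypothesis vE : v \oc q1 = q2 \oc j'.

Lemma coker_right_exact Q3 (q3 : mor B3 Q3) (w : mor Q2 Q3) :
  coker0 S f3 q3 -> w \oc q2 = q3 \oc r' -> coker0 S v w.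
Proof.
move=> hq3 wE; exact: (@ker_left_exact (op C) (op_qab S) _ _ _ _ _ _ _ _ _ _ f3 f2 f1
  (ses_op sB) (ses_op sA) (esym e2) _ _ _ _ _ hq2 hq1 vE _ _ _ hq3 wE).
Qed.

(** The snake morphism is self-dual: the obstruction found in [op C] is again a morphism from K3 to
    Q1 in C, so one vanishing statement serves both ends. *)
Lemma coker_left_exact K3 (k3 : mor K3 A3) :
  ker0 S f3 k3 -> sfac S f3 -> (forall d : mor K3 Q1, d = zr S) -> smono S v.
Proof.
move=> hk /sfac_op sf.
exact: (@ker_right_exact (op C) (op_qab S) _ _ _ _ _ _ _ _ _ _ f3 f2 f1
  (ses_op sB) (ses_op sA) (esym e2) (esym e1) _ _ _ _ _ hq2 hq1 vE _ _ hk sf).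
Qed.

(** It must be shown that A2 covers the image m2 of f2. An element of the image maps into the image
    of f3, so on a cover it is f2 a2 up to some b1 from B1. The class of b1 in Coker f1 dies in
    Coker f2, hence is zero because v is monic, which is where the snake morphism has to vanish. So
    b1 is f1 a1 on a cover, and a2 + j a1 is the lift. *)
Lemma strict_extension K3 (k3 : mor K3 A3) :
  ker0 S f3 k3 -> sfac S f1 -> sfac S f3 -> (forall d : mor K3 Q1, d = zr S) ->
  sfac S f2.
Proof.
move=> hk sf1 sf3 van; have mv := smono_monic (coker_left_exact hk sf3 van).
have [[j0 mj ju] hr] := sA; have [[_ mj' ju'] _] := sB.
have [J2 [m2 hm2]] := has_ker S q2; have [m20 mm2 m2u] := hm2.
have [q20 eq2 q2u] := hq2.
have [e' eE] := m2u _ _ q20.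
exists J2, e', m2; split=> //; last by exists Q2, q2.
have [Q3 [q3 hq3]] := has_coker S f3.
have q3m : q3 \oc (r' \oc m2) = zr S.
  have [t tE] : exists t, t \oc q2 = q3 \oc r'.
    by apply: q2u; rewrite -comp_assoc -e2 comp_assoc; case: hq3 => -> _ _; rewrite comp0l.
  by rewrite comp_assoc -tE -comp_assoc m20 comp0r.
have [T [p [a3 [sp a3E]]]] := sfac_lift sf3 hq3 q3m.
have [T' [p' [a2 [sp' a2E]]]] := sepi_lift a3 (ex_intro _ A1 (ex_intro _ j hr)).
have [b1 b1E] : exists b, j' \oc b = ad S (m2 \oc p \oc p') (ng S (f2 \oc a2)).
  apply: ju'; rewrite compDr compNr !comp_assoc -e2 -a3E.
  by rewrite -!comp_assoc a2E admN.
have q1b1 : q1 \oc b1 = zr S.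
  apply: (monic0 (S := S) mv); rewrite comp_assoc vE -comp_assoc b1E.
  by rewrite compDr compNr !comp_assoc m20 q20 !comp0l admN.
have [T2 [p2 [a1 [sp2 a1E]]]] := sfac_lift sf1 hq1 q1b1.
apply: (@sepi_of_lift _ _ _ _ _ e' (p \oc p' \oc p2) (ad S (a2 \oc p2) (j \oc a1))).
  by apply: sepi_comp => //; apply: sepi_comp.
apply: mm2; rewrite comp_assoc eE compDr !comp_assoc e1 -(comp_assoc j') a1E.
by rewrite (sub_swap (esym b1E)) compDl !comp_assoc.
Qed.

End CokernelSequence.

(** * Slopes *)

Local Open Scope ring_scope.

Section OrderedGroup.
Variables (L : porderZmodType) (hL : totally_ordered_group L).
Implicit Types x y z t : L.

Lemma tog_leP x y : x <= y \/ y < x.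
Proof.
have [h|h] := orP (hL.1 x y); first by left.
by have [->|n] := eqVneq x y; [left|right; rewrite lt_neqAle eq_sym n].
Qed.

Lemma tog_leD x y z t : x <= y -> z <= t -> x + z <= y + t.
Proof.
move=> xy zt; apply: (le_trans (hL.2 _ _ z xy)).
by rewrite ![y + _]addrC; apply: hL.2.
Qed.

Lemma tog_leD2r x y z : x + z <= y + z -> x <= y.
Proof. by move=> /(hL.2 _ _ (- z)); rewrite !addrK. Qed.

Lemma tog_lt_mulrn x y n : x < y -> (0 < n)%N -> x *+ n < y *+ n.
Proof.
move=> xy; case: n => // n _; elim: n => // n IH.
rewrite !(mulrS _ n.+1) lt_neqAle tog_leD ?ltW // andbT; apply/eqP => e.
have : y + x *+ n.+1 <= x + x *+ n.+1 by rewrite e tog_leD // ltW.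
by move/tog_leD2r => yx; move: (lt_le_trans xy yx); rewrite ltxx.
Qed.

Lemma tog_le_mulrn x y n : (0 < n)%N -> (x *+ n <= y *+ n) = (x <= y).
Proof.
move=> n0; have [xy|yx] := tog_leP x y.
  rewrite xy; move: xy; rewrite le_eqVlt => /orP[/eqP->|xy]; first exact: lexx.
  exact/ltW/tog_lt_mulrn.
rewrite (lt_geF yx); apply/negbTE/negP => h.
by move: (lt_le_trans (tog_lt_mulrn yx n0) h); rewrite ltxx.
Qed.

End OrderedGroup.

Section SlopeBounds.
Variables (A : category) (L : porderZmodType) (mu : A -> L).

Definition subs_le (l : L) (X : A) : Prop :=
  forall (N : A) (i : mor N X), is_monic i -> ~ is_zero N -> mu N <= l.

Definition subs_lt (l : L) (X : A) : Prop :=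
  forall (N : A) (i : mor N X), is_monic i -> ~ is_zero N -> mu N < l.

Definition quots_ge (l : L) (X : A) : Prop :=
  forall (N : A) (p : mor X N), is_epi p -> ~ is_zero N -> l <= mu N.

End SlopeBounds.

Section Slopes.
Variables (A : category) (S : qab A) (L : porderZmodType).
Hypotheses (hL : totally_ordered_group L) (hdiv : uniquely_divisible L).
Variable rk : A -> nat.
Hypothesis hrk : rank_function rk.
Variable deg : A -> L.
Hypothesis hdeg : degree_function deg.
Let mu := slope rk deg.
Hypothesis hmu : slope_function mu.
Implicit Types (X Y : A) (l : L).

Lemma rk_gt0 X : ~ is_zero X -> (0 < rk X)%N.
Proof. by case: hrk => _ _ h /h /eqP; rewrite lt0n. Qed.

Lemma slopeE X : ~ is_zero X -> mu X *+ rk X = deg X.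
Proof.
move=> /rk_gt0 /(hdiv (deg X)) [y [yE _]].
exact: (@xgetPex _ 0 [set y : L | y *+ rk X = deg X]%classic (ex_intro _ y yE)).
Qed.

(** Additivity along this sequence forces rank and degree of a zero object to vanish. *)
Lemma zero_short_exact X : is_zero X -> short_exact (idm X) (idm X).
Proof.
move=> /(zeroP S) x0; apply/(short_exactE S).
have k : ker0 S (idm X) (idm X).
  split; first by rewrite comp_idl.
    by move=> T u v; rewrite !comp_idl.
  by move=> T h _; exists h; rewrite comp_idl.
split=> //; split; first by rewrite comp_idl.
  by move=> T u v; rewrite !comp_idr.
by move=> T h _; exists h; rewrite comp_idr.
Qed.

Lemma zero_rk X : is_zero X -> rk X = 0%N.
Proof.
case: hrk => _ h _ /zero_short_exact /h e; apply/eqP.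
by rewrite -(eqn_add2l (rk X)) addn0; apply/eqP.
Qed.

Lemma zero_deg X : is_zero X -> deg X = 0.
Proof.
case: hdeg => _ h /zero_short_exact /h e.
by apply: (addrI (deg X)); rewrite addr0.
Qed.

(** In multiplied form slope bounds add up along short exact sequences, and they still make sense
    for zero objects, where both sides are 0. *)
Lemma slope_le X l : ~ is_zero X -> (mu X <= l) = (deg X <= l *+ rk X).
Proof. by move=> x0; rewrite -slopeE // (tog_le_mulrn hL) // rk_gt0. Qed.

Lemma slope_ge X l : ~ is_zero X -> (l <= mu X) = (l *+ rk X <= deg X).
Proof. by move=> x0; rewrite -slopeE // (tog_le_mulrn hL) // rk_gt0. Qed.

Lemma slope_eq X l : ~ is_zero X -> deg X = l *+ rk X -> mu X = l.
Proof. by move=> x0 e; apply: le_anti; rewrite slope_le // slope_ge // e lexx. Qed.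

Lemma ses_rk X Y Z (i : mor X Y) (p : mor Y Z) : ses S i p -> rk Y = (rk X + rk Z)%N.
Proof. by move=> /short_exactE; case: hrk => _ h _ /h. Qed.

Lemma ses_deg X Y Z (i : mor X Y) (p : mor Y Z) : ses S i p -> deg Y = deg X + deg Z.
Proof. by move=> /short_exactE; case: hdeg => _ h /h. Qed.

Lemma subs_deg l X N (i : mor N X) :
  subs_le mu l X -> is_monic i -> deg N <= l *+ rk N.
Proof.
move=> h mi; have [n0|n0] := pselect (is_zero N).
  by rewrite zero_deg // zero_rk.
by rewrite -slope_le //; apply: h mi n0.
Qed.

Lemma quots_deg l X N (p : mor X N) :
  quots_ge mu l X -> is_epi p -> l *+ rk N <= deg N.
Proof.
move=> h mi; have [n0|n0] := pselect (is_zero N).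
  by rewrite zero_deg // zero_rk.
by rewrite -slope_ge //; apply: h mi n0.
Qed.

Lemma subs_ltW l X : subs_lt mu l X -> subs_le mu l X.
Proof. by move=> h N i mi n0; apply: ltW; apply: h mi n0. Qed.

Lemma subs_le_lt l l' X : subs_le mu l X -> l < l' -> subs_lt mu l' X.
Proof. by move=> h ll N i mi n0; apply: le_lt_trans ll; apply: h mi n0. Qed.

Lemma zero_subs_lt l X : is_zero X -> subs_lt mu l X.
Proof. by move=> x0 N i mi []; apply: (monic_zero S mi). Qed.

(** The condition [deg I = l *+ rk I] expresses that the image is zero or of slope l in one
    equation, ready to be cancelled in degree computations. *)
Lemma strict_of_slopes l X Y (f : mor X Y) : quots_ge mu l X -> subs_le mu l Y ->
  exists I (e : mor X I) (m : mor I Y),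
    [/\ sepi S e, smono S m, m \oc e = f & deg I = l *+ rk I].
Proof.
move=> hX hY; have [I [e [J [j [u [se sj fE mu_ eu]]]]]] := coim_im S f.
have mj := smono_monic sj.
have [i0|i0] := pselect (is_zero I).
  exists I, e, (j \oc u); split=> //; last by rewrite zero_deg // zero_rk.
  exact: zero_smono.
have j0 : ~ is_zero J by move=> j0; apply: i0; apply: (monic_zero S mu_).
have lI : l <= mu I by apply: hX i0; exact: sepi_epi se.
have Jl : mu J <= l by apply: hY mj j0.
have [IJ IJe] := hmu i0 j0 eu mu_.
have eIl : mu I = l by apply: le_anti; rewrite lI (le_trans IJ).
have eJl : mu J = l by apply: le_anti; rewrite Jl (le_trans lI).
exists I, e, (j \oc u); split=> //.
  by apply: smono_ext => //; apply/IJe; rewrite eIl.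
by rewrite -slopeE // eIl.
Qed.

(** A nonzero coimage I with image J would give l <= mu I <= mu J < l. *)
Lemma zero_of_slopes l X Y (f : mor X Y) : quots_ge mu l X -> subs_lt mu l Y -> f = zr S.
Proof.
move=> hX hY; have [I [e [J [j [u [se sj fE mu_ eu]]]]]] := coim_im S f.
have mj := smono_monic sj.
have [i0|i0] := pselect (is_zero I).
  by rewrite -fE (zero_tgt S e i0) comp0r.
have j0 : ~ is_zero J by move=> j0; apply: i0; apply: (monic_zero S mu_).
have lI : l <= mu I by apply: hX i0; exact: sepi_epi se.
have Jl : mu J < l by apply: hY mj j0.
have [IJ _] := hmu i0 j0 eu mu_.
by move: (le_lt_trans (le_trans lI IJ) Jl); rewrite ltxx.
Qed.

(** Pushing G out along a quotient X of K gives a quotient of G that is an extension of I by X. Its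
    degree bound minus the equality for I is the bound for X. [coker_subs_le] argues in the same way
    with preimages. *)
Lemma ker_quots_ge l K G I (k : mor K G) (e : mor G I) :
  ses S k e -> quots_ge mu l G -> deg I = l *+ rk I -> quots_ge mu l K.
Proof.
move=> s hG dI X x ex x0; have [X' [y [e' [k' [ey s']]]]] := pushout_ses s ex.
have := quots_deg hG ey; rewrite (ses_deg s') (ses_rk s') mulrnDr dI.
by move=> /(tog_leD2r hL); rewrite -slope_ge.
Qed.

Lemma coker_subs_le l J H Q (j : mor J H) (p : mor H Q) :
  ses S j p -> subs_le mu l H -> deg J = l *+ rk J -> subs_le mu l Q.
Proof.
move=> s hH dJ X x mx x0; have [X' [y [j' [p' [my s']]]]] := pullback_ses s mx.
have := subs_deg hH my; rewrite (ses_deg s') (ses_rk s') mulrnDr dJ ![l *+ rk J + _]addrC.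
by move=> /(tog_leD2r hL); rewrite -slope_le.
Qed.

Lemma ses_subs_le l X0 X1 X2 (a : mor X0 X1) (b : mor X1 X2) :
  ses S a b -> subs_le mu l X0 -> subs_le mu l X2 -> subs_le mu l X1.
Proof.
move=> s h0 h2 X x mx x0.
have [Y0 [Y2 [i [p [y0 [y2 [s' m0 m2]]]]]]] := ses_lift_monic s mx.
rewrite slope_le // (ses_deg s') (ses_rk s') mulrnDr.
by apply: tog_leD => //; [apply: subs_deg m0|apply: subs_deg m2].
Qed.

Lemma in_slope_deg l X : in_slope_subcat mu l X -> deg X = l *+ rk X.
Proof.
case=> [x0|[[x0 _] <-]]; last by rewrite slopeE.
by rewrite zero_deg // zero_rk.
Qed.

Lemma in_slope_subs l X : in_slope_subcat mu l X -> subs_le mu l X.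
Proof.
by case=> [/zero_subs_lt h|[[_ h] <-]]; [apply: subs_ltW|exact: h].
Qed.

Lemma in_slopeI l X : deg X = l *+ rk X -> subs_le mu l X -> in_slope_subcat mu l X.
Proof.
move=> d h; have [x0|x0] := pselect (is_zero X); [by left|right].
have e := slope_eq x0 d; split=> //; split=> // N i mi n0.
by rewrite e; apply: h mi n0.
Qed.

(* B -> X -> G stands for W_{<l} -> W_{<=l} -> gr_l of the source and the primed
   objects for those of the target. *)
Section Step.
Variables (l : L) (B X G B' X' G' : A).
Variables (i : mor B X) (p : mor X G) (i' : mor B' X') (p' : mor X' G').
Variables (g : mor B B') (h : mor X X') (Qg : A) (qg : mor B' Qg).
Hypotheses (s : ses S i p) (s' : ses S i' p') (comm : h \oc i = i' \oc g).
Hypotheses (hG : quots_ge mu l G) (hG' : subs_le mu l G').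
Hypotheses (sg : sfac S g) (hqg : coker0 S g qg) (hQg : subs_lt mu l Qg).

Lemma step_gr : exists f3 : mor G G', f3 \oc p = p' \oc h.
Proof.
case: s => _ [_ _]; apply; rewrite -comp_assoc comm comp_assoc.
by case: s' => -[-> _ _] _; rewrite comp0l.
Qed.

Lemma step_ker (f3 : mor G G') : exists K3 (k3 : mor K3 G),
  [/\ ker0 S f3 k3, sfac S f3, quots_ge mu l K3 & forall d : mor K3 Qg, d = zr S].
Proof.
have [I [e [m [se sm me dI]]]] := strict_of_slopes f3 hG hG'.
have [K3 [k3 hk3]] := has_ker S f3; exists K3, k3.
have mm := smono_monic sm.
have hk : ker0 S e k3.
  case: hk3 => k0 mk ku; split=> // [|T t et].
    by apply: (monic0 (S := S) mm); rewrite comp_assoc me.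
  by apply: ku; rewrite -me -comp_assoc et comp0r.
have hK := ker_quots_ge (ker_ses hk se) hG dI.
split=> //; first by exists I, e, m.
by move=> d; apply: zero_of_slopes hK hQg.
Qed.

Lemma step_strict : sfac S h.
Proof.
have [f3 f3E] := step_gr; have [K3 [k3 [hk sf _ van]]] := step_ker f3.
have [Q [q hq]] := has_coker S h.
have [v vE] : exists v, v \oc qg = q \oc i'.
  case: hqg => _ _; apply; rewrite -comp_assoc -comm comp_assoc.
  by case: hq => -> _ _; rewrite comp0l.
exact: (strict_extension s s' comm f3E hqg hq vE hk sg sf van).
Qed.

Variables (Q : A) (q : mor X' Q) (v : mor Qg Q).
Hypotheses (hq : coker0 S h q) (vE : v \oc qg = q \oc i').

Lemma step_coker_smono : smono S v.
Proof.
have [f3 f3E] := step_gr; have [K3 [k3 [hk sf _ van]]] := step_ker f3.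
exact: (coker_left_exact s s' comm f3E hqg hq vE hk sf van).
Qed.

(** W is the graded piece of the cokernel. By right exactness it is Coker f3, the quotient of G' by
    the image I of f3. *)
Lemma step_coker_gr W (w : mor Q W) : coker0 S v w ->
  exists I (m : mor I G') (q3 : mor G' W), ses S m q3 /\ deg I = l *+ rk I.
Proof.
move=> hw; have [f3 f3E] := step_gr; have [Q3 [q3 hq3]] := has_coker S f3.
have [w' w'E] : exists w', w' \oc q = q3 \oc p'.
  case: hq => _ _; apply; rewrite -comp_assoc -f3E comp_assoc.
  by case: hq3 => -> _ _; rewrite comp0l.
have hw' := coker_right_exact s s' f3E hqg hq vE hq3 w'E.
have [t [ti tE]] := coker_unique hw' hw; have hq3' := coker_iso hq3 ti.
have [I [e [m [se sm me dI]]]] := strict_of_slopes f3 hG hG'.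
exists I, m, (t \oc q3); split=> //.
by apply: coker_ses sm; apply: sfac_coker (sepi_epi se) me hq3'.
Qed.

Lemma step_coker_subs W (w : mor Q W) : coker0 S v w -> subs_le mu l W.
Proof.
by move=> /step_coker_gr[I [m [q3 [t dI]]]]; apply: coker_subs_le t hG' dI.
Qed.

(** Q is an extension of its graded piece by Qg, and both satisfy the bound l. This is what the
    induction hands on from l. *)
Lemma step_subs_le : subs_le mu l Q.
Proof.
have [W [w hw]] := has_coker S v.
apply: (ses_subs_le (coker_ses hw step_coker_smono)); first exact: subs_ltW.
exact: step_coker_subs hw.
Qed.

Lemma step_coker_slope W (w : mor Q W) : coker0 S v w ->
  in_slope_subcat mu l G' -> in_slope_subcat mu l W.
Proof.
move=> hw /in_slope_deg dG'; apply: in_slopeI (step_coker_subs hw).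
have [I [m [q3 [t dI]]]] := step_coker_gr hw.
move: (ses_deg t); rewrite dG' (ses_rk t) mulrnDr dI.
by move/addrI.
Qed.

Variables (Kg K : A) (kg : mor Kg B) (k : mor K X) (u : mor Kg K).
Hypotheses (hkg : ker0 S g kg) (hk : ker0 S h k) (uE : k \oc u = i \oc kg).

(** As the snake morphism vanishes, K -> Ker f3 is a strict epi with kernel Kg. So the graded piece
    W of the kernel is all of Ker f3, and I is the coimage of f3. *)
Lemma step_ker_gr W (w : mor K W) : coker0 S u w ->
  exists I (k3 : mor W G) (e : mor G I), [/\ ses S k3 e, deg I = l *+ rk I & quots_ge mu l W].
Proof.
move=> hw; have [f3 f3E] := step_gr; have [K3 [k3 [hk3 sf hK van]]] := step_ker f3.
have [w' w'E] : exists w', k3 \oc w' = p \oc k.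
  case: hk3 => _ _; apply; rewrite comp_assoc f3E -comp_assoc.
  by case: hk => -> _ _; rewrite comp0r.
have sw' := ker_right_exact s s' comm f3E hk hk3 w'E hqg sg van.
have [_ hw'] := ker_ses (ker_left_exact s s' comm hk hk3 w'E hkg uE) sw'.
have [t [ti tE]] := coker_unique hw hw'.
have hk3' := ker_iso hk3 ti.
have [I [e [m [se sm me dI]]]] := strict_of_slopes f3 hG hG'.
have ke : ses S (k3 \oc t) e.
  apply: ker_ses => //; case: hk3' => k0 mk ku; have mm := smono_monic sm.
  split=> // [|T y ey].
    by apply: (monic0 (S := S) mm); rewrite comp_assoc me.
  by apply: ku; rewrite -me -comp_assoc ey comp0r.
exists I, (k3 \oc t), e; split=> //; exact: ker_quots_ge ke hG dI.
Qed.

(** Subobjects of W are subobjects of G, which bounds their slopes; the degree of W follows by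
    cancelling that of I from that of G. *)
Lemma step_ker_slope W (w : mor K W) : coker0 S u w ->
  in_slope_subcat mu l G -> in_slope_subcat mu l W.
Proof.
move=> /step_ker_gr[I [k3 [e [t dI _]]]] hs.
apply: in_slopeI; last first.
  move=> N n mn; apply: (in_slope_subs hs (i := k3 \oc n)).
  case: t => -[_ mk _] _ T a b; rewrite -!comp_assoc => /mk; exact: mn.
move: (ses_deg t); rewrite (in_slope_deg hs) (ses_rk t) mulrnDr dI.
by move/addIr.
Qed.

End Step.

End Slopes.

(** * Pointwise kernels and cokernels of functors *)

Section Isomorphisms.
Variable C : category.
Implicit Types X Y Z : C.

Lemma iso_id X : is_iso (idm X).
Proof. by exists (idm X); rewrite comp_idl. Qed.

Lemma iso_cancel_l X Y Z (f : mor X Y) (g : mor Y Z) :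
  is_iso g -> is_iso (g \oc f) -> is_iso f.
Proof.
move=> gi [s [s1 s2]]; exists (s \oc g); split; first by rewrite -comp_assoc.
have [t [tg gt]] := gi.
by rewrite -[LHS]comp_idl -tg -!comp_assoc [g \oc _]comp_assoc [g \oc f \oc _]comp_assoc s2
  comp_idl.
Qed.

Lemma iso_cancel_r X Y Z (f : mor X Y) (g : mor Y Z) :
  is_iso f -> is_iso (g \oc f) -> is_iso g.
Proof.
move=> fi [s [s1 s2]]; exists (f \oc s); split; last by rewrite comp_assoc.
have [t [tf ft]] := fi.
by rewrite -[LHS]comp_idr -ft !comp_assoc -(comp_assoc (f \oc s)) -(comp_assoc f) s1 comp_idr.
Qed.

(** Proved for [is_coker] in a bare category because it is applied in [Wpre], which is not given an
    [additive_str]. *)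
Lemma is_coker_iso X Y (f : mor X Y) Q (q : mor Y Q) Q' (q' : mor Y Q') :
  is_coker f q -> is_coker f q' ->
  exists (t : mor Q Q') (s : mor Q' Q), [/\ t \oc q = q', s \oc t = idm Q & t \oc s = idm Q'].
Proof.
move=> [q0 qu] [q0' qu'].
have [t [tE _]] := qu _ _ q0'; have [s [sE _]] := qu' _ _ q0.
exists t, s; split=> //.
  have [w [_ wu]] := qu _ _ q0.
  by rewrite -(wu (s \oc t)) ?(wu (idm Q)) ?comp_idl // -comp_assoc tE.
have [w [_ wu]] := qu' _ _ q0'.
by rewrite -(wu (t \oc s)) ?(wu (idm Q')) ?comp_idl // -comp_assoc sE.
Qed.

Lemma is_ker_iso X Y (f : mor X Y) K (k : mor K X) K' (k' : mor K' X) :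
  is_ker f k -> is_ker f k' ->
  exists (t : mor K' K) (s : mor K K'), [/\ k \oc t = k', s \oc t = idm K' & t \oc s = idm K].
Proof.
move=> [q0 qu] [q0' qu'].
have [t [tE _]] := qu _ _ q0'; have [s [sE _]] := qu' _ _ q0.
exists t, s; split=> //.
  have [w [_ wu]] := qu' _ _ q0'.
  by rewrite -(wu (s \oc t)) ?(wu (idm K')) ?comp_idr // comp_assoc sE.
have [w [_ wu]] := qu _ _ q0.
by rewrite -(wu (t \oc s)) ?(wu (idm K)) ?comp_idr // comp_assoc tE.
Qed.

End Isomorphisms.

Section StrictMonic.
Variables (C : category) (S : qab C).

Lemma strict_monicE (X Y : C) (f : mor X Y) : strict f /\ is_monic f <-> smono S f.
Proof.
split=> [[[I [c [J [i [u [[K [k [/(is_kerE S) hk /(is_cokerE S) hc]]]]]]]]]]|sf].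
  move=> [Q [q [_ /(is_kerE S) hi]]] fE ui mf; rewrite fE.
  apply: smono_ext; first by apply: smono_ext => //; exists Q, q.
  apply: (monic_sepi_iso (S := S)); last by exists K, k.
  by move=> T a b ab; apply: mf; rewrite fE -!comp_assoc ab.
have mf := smono_monic sf; split=> //.
have [K [k hk]] := has_ker S f; have [Q [q hq]] := has_coker S f.
have k0 : k = zr S by apply: (monic0 (S := S) mf); case: hk.
exists X, (idm X), X, f, (idm X); split; last exact: iso_id.
- exists K, k; split; first exact/(is_kerE S).
  apply/(is_cokerE S); rewrite k0; split; first exact: comp0r.
    by move=> T u v; rewrite !comp_idr.
  by move=> T h _; exists h; rewrite comp_idr.
- exists Q, q; split; first exact/(is_cokerE S).
  exact/(is_kerE S)/smono_ker.
- by rewrite !comp_idr.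
Qed.

End StrictMonic.

Section Pointwise.
Variables (J C : category) (S : qab C).
Implicit Types F G : functor J C.

Definition pcoker F G (f : nattrans F G) Q (q : nattrans G Q) : Prop :=
  forall i, coker0 S (f i) (q i).

Definition pker F G (f : nattrans F G) K (k : nattrans K F) : Prop :=
  forall i, ker0 S (f i) (k i).

Lemma pcoker_exists F G (f : nattrans F G) : exists Q (q : nattrans G Q), pcoker f q.
Proof.
have h i := cid (has_coker S (f i)).
pose Q i := projT1 (h i); pose q i : mor (G i) (Q i) := projT1 (cid (projT2 (h i))).
have hq i : coker0 S (f i) (q i) := projT2 (cid (projT2 (h i))).
have eq i : is_epi (q i) by case: (hq i).
have H i j (a : mor i j) : {u : mor (Q i) (Q j) | u \oc q i = q j \oc fmap G a}.
  apply: cid; case: (hq i) => _ _; apply; rewrite -comp_assoc -naturality comp_assoc.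
  by case: (hq j) => -> _ _; rewrite comp0l.
have m1 i : sval (H i i (idm i)) = idm (Q i).
  by apply: eq; rewrite (svalP (H _ _ _)) fmap_id comp_idl comp_idr.
have m2 i j k (b : mor j k) (a : mor i j) :
    sval (H i k (b \oc a)) = sval (H j k b) \oc sval (H i j a).
  apply: eq; rewrite -comp_assoc !(svalP (H _ _ _)) comp_assoc (svalP (H _ _ _)).
  by rewrite -comp_assoc -fmap_comp.
exists (@Functor J C Q (fun i j a => sval (H i j a)) m1 m2).
by exists (@NatTrans _ _ G (@Functor J C Q (fun i j a => sval (H i j a)) m1 m2) q
  (fun i j a => esym (svalP (H i j a)))).
Qed.

Lemma pker_exists F G (f : nattrans F G) : exists K (k : nattrans K F), pker f k.
Proof.
have h i := cid (has_ker S (f i)).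
pose K i := projT1 (h i); pose k i : mor (K i) (F i) := projT1 (cid (projT2 (h i))).
have hk i : ker0 S (f i) (k i) := projT2 (cid (projT2 (h i))).
have mk i : is_monic (k i) by case: (hk i).
have H i j (a : mor i j) : {u : mor (K i) (K j) | k j \oc u = fmap F a \oc k i}.
  apply: cid; case: (hk j) => _ _; apply; rewrite comp_assoc naturality -comp_assoc.
  by case: (hk i) => -> _ _; rewrite comp0r.
have m1 i : sval (H i i (idm i)) = idm (K i).
  by apply: mk; rewrite (svalP (H _ _ _)) fmap_id comp_idl comp_idr.
have m2 i j l (b : mor j l) (a : mor i j) :
    sval (H i l (b \oc a)) = sval (H j l b) \oc sval (H i j a).
  apply: mk; rewrite comp_assoc !(svalP (H _ _ _)) -comp_assoc (svalP (H _ _ _)).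
  by rewrite comp_assoc -fmap_comp.
exists (@Functor J C K (fun i j a => sval (H i j a)) m1 m2).
by exists (@NatTrans _ _ (@Functor J C K (fun i j a => sval (H i j a)) m1 m2) F k
  (fun i j a => svalP (H i j a))).
Qed.

Lemma pcoker_lift F G (f : nattrans F G) Q (q : nattrans G Q) T (h : nattrans G T) :
  pcoker f q -> (forall i, h i \oc f i = zr S) ->
  exists! u : nattrans Q T, nat_comp u q = h.
Proof.
move=> hq h0; have eq i : is_epi (q i) by case: (hq i).
have H i : {u : mor (Q i) (T i) | u \oc q i = h i}.
  by apply: cid; case: (hq i) => _ _; apply.
have nat i j (a : mor i j) : sval (H j) \oc fmap Q a = fmap T a \oc sval (H i).
  apply: eq; rewrite -!comp_assoc (svalP (H i)) -naturality comp_assoc (svalP (H j)).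
  exact: naturality.
exists (@NatTrans _ _ Q T (fun i => sval (H i)) nat); split.
  by apply: nattrans_ext => i /=; rewrite (svalP (H i)).
move=> u uE; apply: nattrans_ext => i /=; apply: eq; rewrite (svalP (H i)) -uE //.
Qed.

Lemma pker_lift F G (f : nattrans F G) K (k : nattrans K F) T (h : nattrans T F) :
  pker f k -> (forall i, f i \oc h i = zr S) ->
  exists! u : nattrans T K, nat_comp k u = h.
Proof.
move=> hk h0; have mk i : is_monic (k i) by case: (hk i).
have H i : {u : mor (T i) (K i) | k i \oc u = h i}.
  by apply: cid; case: (hk i) => _ _; apply.
have nat i j (a : mor i j) : sval (H j) \oc fmap T a = fmap K a \oc sval (H i).
  apply: mk; rewrite !comp_assoc (svalP (H j)) (naturality k) -comp_assoc (svalP (H i)).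
  exact: naturality.
exists (@NatTrans _ _ T K (fun i => sval (H i)) nat); split.
  by apply: nattrans_ext => i /=; rewrite (svalP (H i)).
move=> u uE; apply: nattrans_ext => i /=; apply: mk; rewrite (svalP (H i)) -uE //.
Qed.

Definition nat_zero F G : nattrans F G :=
  @NatTrans J C F G (fun _ => zr S)
    (fun i j a => etrans (comp0l S _ (fmap F a)) (esym (comp0r S _ (fmap G a)))).

(** The identity then equals the zero transformation. Only endomorphisms of F matter, so the
    argument covers zero objects of [Fun] and of its full subcategories alike. *)
Lemma endo_unique_zero F : (forall s t : nattrans F F, s = t) -> forall i, is_zero (F i).
Proof.
move=> h i; apply/(zeroP S).
exact: (f_equal (fun s : nattrans F F => s i) (h (nat_id F) (nat_zero F F))).
Qed.

Variable Z : C.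
Hypothesis hZ : is_zero Z.

Definition const_zero : functor J C :=
  @Functor J C (fun _ => Z) (fun _ _ _ => idm Z) (fun _ => erefl)
    (fun _ _ _ _ _ => esym (comp_idl (idm Z))).

Lemma pzero_unique F G : (forall i, is_zero (F i)) \/ (forall i, is_zero (G i)) ->
  exists! f : nattrans F G, True.
Proof.
move=> h; exists (nat_zero F G); split=> // f _; apply: nattrans_ext => i /=.
by case: h => h; [apply/esym/zero_src|apply/esym/zero_tgt].
Qed.

Lemma fun_zero_morE F G (f : @mor (Fun J C) F G) :
  zero_mor f <-> forall i, component f i = zr S.
Proof.
split=> [[W [v [u [[hW _] ->]]]] i|h].
  have W0 : is_zero (W i).
    apply: endo_unique_zero => s t; have [w [_ wu]] := hW W.
    exact: etrans (esym (wu s I)) (wu t I).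
  by rewrite /= (zero_src S (component v i) W0) comp0l.
exists const_zero, (nat_zero _ _), (nat_zero _ _); split.
  by split=> X; apply: pzero_unique => //; [right|left].
by apply: nattrans_ext => i /=; rewrite h comp0l.
Qed.

(** A zero morphism of the subcategory has to factor through a zero object of that subcategory;
    [P const_zero] supplies one. *)
Lemma full_zero_morE (P : Fun J C -> Prop) (F G : full_subcat P) (f : mor F G) :
  P const_zero -> zero_mor f <-> forall i, component f i = zr S.
Proof.
move=> P0; split=> [[W [v [u [[hW _] ->]]]] i|h].
  have W0 : is_zero (sval W i).
    apply: endo_unique_zero => s t; have [w [_ wu]] := hW W.
    exact: etrans (esym (wu s I)) (wu t I).
  by rewrite /= (zero_src S (component v i) W0) comp0l.
exists (exist _ const_zero P0), (nat_zero _ _), (nat_zero _ _); split.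
  by split=> X; apply: pzero_unique => //; [right|left].
by apply: nattrans_ext => i /=; rewrite h comp0l.
Qed.

Lemma pcoker_fun F G (f : @mor (Fun J C) F G) Q (q : @mor (Fun J C) G Q) :
  pcoker f q -> is_coker f q.
Proof.
move=> hq; split; first by apply/fun_zero_morE => i /=; case: (hq i).
by move=> T h /fun_zero_morE h0; apply: pcoker_lift hq h0.
Qed.

Lemma pker_fun F G (f : @mor (Fun J C) F G) K (k : @mor (Fun J C) K F) :
  pker f k -> is_ker f k.
Proof.
move=> hk; split; first by apply/fun_zero_morE => i /=; case: (hk i).
by move=> T h /fun_zero_morE h0; apply: pker_lift hk h0.
Qed.

Lemma pcoker_full (P : Fun J C -> Prop) (F G Q : full_subcat P) (f : mor F G) (q : mor G Q) :
  P const_zero -> pcoker f q -> is_coker f q.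
Proof.
move=> P0 hq; split; first by apply/full_zero_morE => // i /=; case: (hq i).
by move=> T h /full_zero_morE h0; apply: pcoker_lift hq (h0 P0).
Qed.

Lemma pker_full (P : Fun J C -> Prop) (F G K : full_subcat P) (f : mor F G) (k : mor K F) :
  P const_zero -> pker f k -> is_ker f k.
Proof.
move=> P0 hk; split; first by apply/full_zero_morE => // i /=; case: (hk i).
by move=> T h /full_zero_morE h0; apply: pker_lift hk (h0 P0).
Qed.

End Pointwise.

(** * Filtrations *)

Section Filtrations.
Variables (A : category) (S : qab A) (L : porderZmodType) (hL : totally_ordered_group L).
Implicit Types (F : functor (poset_cat L) A) (b : seq L) (l x y : L).

Definition tr F x y (h : x <= y) : mor (F x) (F y) := @fmap _ _ F x y h.

Lemma tr_irr F x y (h h' : x <= y) : tr F h = tr F h'.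
Proof. by congr tr; exact: bool_irrelevance. Qed.

Lemma tr_comp F x y z (xy : x <= y) (yz : y <= z) (xz : x <= z) :
  tr F yz \oc tr F xy = tr F xz.
Proof. by rewrite /tr -fmap_comp; congr fmap; exact: bool_irrelevance. Qed.

Lemma tr_id F x (h : x <= x) : tr F h = idm (F x).
Proof. by rewrite -fmap_id /tr; congr fmap; exact: bool_irrelevance. Qed.

Lemma last_such b (P : pred L) :
  (forall z, z \in b -> ~~ P z) \/
  exists z, [/\ z \in b, P z & forall w, w \in b -> P w -> w <= z].
Proof.
elim: b => [|a b [no|[z [zb Pz zM]]]]; first by left.
- case: (boolP (P a)) => Pa; [right|left].
    exists a; split=> //; first exact: mem_head.
    by move=> w; rewrite inE => /orP[/eqP->//|/no /negP].
  by move=> z; rewrite inE => /orP[/eqP->|/no].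
- right; case: (boolP (P a)) => Pa; last first.
    exists z; split=> //; first by rewrite inE zb orbT.
    move=> w; rewrite inE => /orP[/eqP->|wb]; first by rewrite (negbTE Pa).
    exact: zM.
  have [za|az] := tog_leP hL z a.
    exists a; split=> //; first exact: mem_head.
    move=> w; rewrite inE => /orP[/eqP->//|wb Pw].
    exact: le_trans (zM _ wb Pw) za.
  exists z; split=> //; first by rewrite inE zb orbT.
  by move=> w; rewrite inE => /orP[/eqP-> _|]; [exact: ltW|exact: zM].
Qed.

(* F is zero before b and locally constant away from b; unlike the breaks of
   finite_filtration, b is unordered and may be enlarged freely. *)
Definition breaks_in F b : Prop :=
  (forall x, (forall z, z \in b -> x < z) -> is_zero (F x)) /\
  (forall x y (h : x <= y), (forall z, z \in b -> ~~ (x < z <= y)) -> is_iso (tr F h)).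

(** Colimit-free form of the requirement that each W_{<=l} is a strict subobject of the colimit; in
    the presence of breaks the two are equivalent. *)
Definition smono_tr F : Prop := forall x y (h : x <= y), smono S (tr F h).

Lemma breaks_inS F b b' : {subset b <= b'} -> breaks_in F b -> breaks_in F b'.
Proof.
move=> s [h0 h1]; split=> [x hx|x y h hx].
  by apply: h0 => z /s; apply: hx.
by apply: h1 => z /s; apply: hx.
Qed.

Lemma finite_filtration_breaks F :
  finite_filtration F -> smono_tr F /\ exists b, breaks_in F b.
Proof.
move=> [M [c [[cc _] sc [b [sb b0 b1 b2]]]]].
have sm x := (strict_monicE S (c x)).1 (sc x).
have ctr x y (h : x <= y) : c y \oc tr F h = c x by exact: cc.
split.
  by move=> x y h; apply: (@smono_cancel _ _ _ _ _ _ (c y)); rewrite ctr.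
exists b; split=> // x y h hx.
have [no|[z [zb zx zM]]] := last_such b (fun w => w <= x).
  have xb w : w \in b -> x < w.
    by move=> wb; have [wx|//] := tog_leP hL w x; move: (no w wb); rewrite wx.
  have yb w : w \in b -> y < w.
    move=> wb; have [wy|//] := tog_leP hL w y.
    by move: (hx w wb); rewrite xb // wy.
  by apply: (zero_iso S); apply: b0.
(* F is constant from the break z up to the next one; after the last break this is seen by comparing
   with the colimit. As z is the last break below x and also below y, both F x and F y are
   isomorphic to F z. *)
have key t (zt : z <= t) : (forall w, w \in b -> w <= t -> w <= z) -> is_iso (tr F zt).
  move=> tM; set i := index z b; have zE : b`_i = z by rewrite nth_index.
  have ib : (i < size b)%N by rewrite index_mem.
  case: (ltnP i.+1 (size b)) => hi.
    have tb : t < b`_i.+1.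
      have [bt|//] := tog_leP hL b`_i.+1 t.
      have := tM _ (mem_nth 0 hi) bt; rewrite -{1}zE => h2.
      have h3 : b`_i < b`_i.+1 by rewrite (sorted_ltn_nth lt_trans) ?inE.
      by move: (lt_le_trans h3 h2); rewrite ltxx.
    by move: (b1 i hi t); rewrite zE => /(_ zt tb).
  have big w : w \in b -> w <= z.
    move=> wb; rewrite -(nth_index 0 wb) -zE.
    have : (index w b <= i)%N by move: wb; rewrite -index_mem => wb; rewrite -ltnS (leq_trans wb).
    rewrite leq_eqVlt => /orP[/eqP->//|hw]; apply: ltW.
    by rewrite (sorted_ltn_nth lt_trans) ?inE// index_mem.
  apply: (iso_cancel_l (g := c t)); first by apply: b2 => w wb; apply: le_trans zt; exact: big.
  by rewrite ctr; apply: b2.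
have zy := le_trans zx h.
apply: (iso_cancel_r (f := tr F zx)); first exact: key.
rewrite (tr_comp _ _ _ zy); apply: key => w wb wy.
have [wx|xw] := tog_leP hL w x; first exact: zM.
by move: (hx w wb); rewrite xw wy.
Qed.

Lemma upper_bound x y : exists z, x <= z /\ y <= z.
Proof.
by have [xy|/ltW yx] := tog_leP hL x y; [exists y|exists x]; rewrite lexx.
Qed.

Lemma breaks_top b : exists t, forall z, z \in b -> z <= t.
Proof.
have [no|[t [_ _ tM]]] := last_such b predT; last by exists t => z zb; apply: tM.
by exists 0 => z /no.
Qed.

Lemma breaks_finite_filtration F b :
  smono_tr F -> breaks_in F b -> finite_filtration F.
Proof.
move=> sF [b0 b1]; have [t tM] := breaks_top b.
have mF x y (h : x <= y) : is_monic (tr F h) by apply: (smono_monic (S := S)).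
have cst x y (h : x <= y) : t <= x -> is_iso (tr F h).
  move=> tx; apply: b1 => z /tM zt; apply/negP => /andP[xz _].
  by move: (lt_le_trans xz (le_trans zt tx)); rewrite ltxx.
(* Coprojections to the colimit F t: a transition map for l <= t, the inverse of one beyond t.
   Describing them after composition into every F z above both treats the two cases uniformly. *)
have H l : {c : mor (F l) (F t) |
    forall z (lz : l <= z) (tz : t <= z), tr F tz \oc c = tr F lz}.
  apply: cid; have [lt|/ltW tl] := tog_leP hL l t.
    by exists (tr F lt) => z lz tz; apply: tr_comp.
  have [g [g1 g2]] := cst t l tl (lexx _); exists g => z lz tz.
  by rewrite -(tr_comp F tl lz tz) -comp_assoc g2 comp_idr.
have cid_t : sval (H t) = idm (F t).
  by apply: (mF t t (lexx t)); rewrite (svalP (H t)) tr_id comp_idl.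
exists (F t), (fun l => sval (H l)); split.
- split=> [x y h|T s sc].
    have [z [yz tz]] := upper_bound y t.
    apply: (mF t z tz); rewrite comp_assoc (svalP (H y) z yz) (svalP (H x) z (le_trans h yz)).
    exact: tr_comp.
  exists (s t); split=> [l|u uE]; last by rewrite -uE cid_t comp_idr.
  have [z [lz tz]] := upper_bound l t.
  rewrite -(sc t z tz) -(sc l z lz) -comp_assoc; congr (_ \oc _).
  exact: (svalP (H l)).
- move=> l; apply/(strict_monicE S).
  have [z [lz tz]] := upper_bound l t.
  by apply: (@smono_cancel _ _ _ _ _ _ (tr F tz)); rewrite (svalP (H l) z lz).
- have mem z : (z \in sort <=%R (undup b)) = (z \in b) by rewrite mem_sort mem_undup.
  have sb : sorted <%R (sort <=%R (undup b)).
    rewrite lt_sorted_uniq_le sort_uniq undup_uniq /=.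
    by apply: sort_sorted; exact: hL.1.
  exists (sort <=%R (undup b)); split=> //.
  + by move=> l hl; apply: b0 => z zb; apply: hl; rewrite mem.
  + move=> i hi l h lt; apply: b1 => z; rewrite -mem => zb.
    apply/negP => /andP[iz zl].
    have zE := nth_index 0 zb.
    have zs : (index z (sort <=%R (undup b)) < size (sort <=%R (undup b)))%N.
      by rewrite index_mem.
    case: (ssrnat.ltngtP (index z (sort <=%R (undup b))) i) => hz.
    * have : z < (sort <=%R (undup b))`_i.
        by rewrite -[X in X < _]zE (sorted_ltn_nth lt_trans) ?inE // ltnW.
      by move=> /lt_trans /(_ iz); rewrite ltxx.
    * have : (sort <=%R (undup b))`_i.+1 <= z.
        move: hz; rewrite leq_eqVlt => /orP[/eqP ->|hz]; first by rewrite zE.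
        by apply: ltW; rewrite -[X in _ < X]zE (sorted_ltn_nth lt_trans) ?inE.
      by move=> h2; move: (lt_le_trans lt (le_trans h2 zl)); rewrite ltxx.
    * by move: iz; rewrite -hz zE ltxx.
  + move=> l hl; have [z [lz tz]] := upper_bound l t.
    apply: (iso_cancel_l (g := tr F tz)); first exact: cst.
    rewrite (svalP (H l) z lz); apply: b1 => w wb; apply/negP => /andP[lw _].
    have wl : w <= l by apply: hl; rewrite mem.
    by move: (lt_le_trans lw wl); rewrite ltxx.
Qed.

(** The part of [is_gr] that concerns W_{<l}: i is a model of its morphism to W_{<=l}. *)
Definition lt_sub F l B (i : mor B (F l)) : Prop :=
  exists c : forall t, mor (restrict (fun x : poset_cat L => x < l) F t) B,
    is_colim c /\ forall x (h : x < l), i \oc c (exist _ x h) = tr F (ltW h).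

Lemma is_grI F l B (i : mor B (F l)) G (q : mor (F l) G) :
  lt_sub i -> coker0 S i q -> is_gr F l G.
Proof. by move=> [c [hc ci]] /is_cokerE hq; exists B, c, i, q. Qed.

(** Two models of W_{<l} map to each other over F l, so their morphisms to F l have the same
    cokernels. Conditions on all models of gr_l can thus be checked with one chosen i. *)
Lemma is_gr_coker F l B (i : mor B (F l)) G :
  lt_sub i -> is_gr F l G -> exists q : mor (F l) G, coker0 S i q.
Proof.
move=> [c [[cc cu] ci]] [B' [c' [i' [q [[cc' cu'] ci' /(is_cokerE S) [q0 eq qu]]]]]].
have [t [tE _]] := cu _ _ cc'; have [s [sE _]] := cu' _ _ cc.
have it : i' \oc t = i.
  have iC : is_cocone (fun z => i \oc c z).
    by move=> x y a; rewrite -comp_assoc cc.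
  have [w [_ wu]] := cu _ _ iC; rewrite -(wu i) // -(wu (i' \oc t)) //.
  by case=> x h; rewrite -comp_assoc tE ci ci'.
have is' : i \oc s = i'.
  have iC : is_cocone (fun z => i' \oc c' z).
    by move=> x y a; rewrite -comp_assoc cc'.
  have [w [_ wu]] := cu' _ _ iC; rewrite -(wu i') // -(wu (i \oc s)) //.
  by case=> x h; rewrite -comp_assoc sE ci ci'.
exists q; split=> //; first by rewrite -it comp_assoc q0 comp0l.
by move=> T h hi; apply: qu; rewrite -is' comp_assoc hi comp0l.
Qed.

Lemma lt_sub_zero F l B (i : mor B (F l)) :
  is_zero B -> (forall x, x < l -> is_zero (F x)) -> lt_sub i.
Proof.
move=> hB hF.
exists (fun=> zr S); split; last first.
  by move=> x h; rewrite comp0r; apply/esym/zero_src/hF.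
split=> [x y a|T t _]; first by rewrite comp0l.
exists (zr S); split=> [x|u _]; last by rewrite (zero_src S u hB).
by rewrite comp0l; apply/esym/zero_src/hF/(svalP x).
Qed.

(** F being constant on the interval from m to l, the colimit over x < l is attained at m. *)
Lemma lt_sub_step F l m (ml : m < l) : smono_tr F ->
  (forall x (mx : m <= x), x < l -> is_iso (tr F mx)) -> lt_sub (tr F (ltW ml)).
Proof.
move=> sF cst.
have mF x y (h : x <= y) : is_monic (tr F h) by apply: (smono_monic (S := S)).
have H (x : {x : L | x < l}) : {c : mor (F (sval x)) (F m) |
    tr F (ltW ml) \oc c = tr F (ltW (svalP x))}.
  apply: cid; case: x => x xl /=; have [xm|/ltW mx] := tog_leP hL x m.
    by exists (tr F xm); apply: tr_comp.
  have [g [g1 g2]] := cst x mx xl; exists g.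
  by rewrite -(tr_comp F mx (ltW xl)) -comp_assoc g2 comp_idr; exact: tr_irr.
exists (fun z => sval (H z)); split; last first.
  by move=> x h; rewrite (svalP (H _)); exact: tr_irr.
split=> [x y a|T t tc].
  by apply: (mF _ _ (ltW ml)); rewrite comp_assoc !(svalP (H _)); apply: tr_comp.
exists (t (exist _ m ml)); split=> [x|u uE].
  have [z [xz mz zl]] : exists z, [/\ sval x <= z, m <= z & z < l].
    have [xm|/ltW mx] := tog_leP hL (sval x) m; first by exists m.
    by exists (sval x); split=> //; exact: svalP x.
  rewrite -(tc (exist _ m ml) (exist _ z zl) mz) -(tc x (exist _ z zl) xz) -comp_assoc.
  congr (_ \oc _); apply: (mF _ _ (ltW zl)); rewrite comp_assoc.
  have -> : @fmap _ _ (restrict (fun x : poset_cat L => x < l) F)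
    (exist _ m ml) (exist _ z zl) mz = tr F mz by [].
  by rewrite (tr_comp F mz (ltW zl) (ltW ml)) (svalP (H x)); apply/esym/tr_comp.
rewrite -uE; have -> : sval (H (exist _ m ml)) = idm (F m); last by rewrite comp_idr.
apply: (mF _ _ (ltW ml)); rewrite (svalP (H _)) comp_idr.
exact: tr_irr.
Qed.

Section Below.
Variables (b : seq L) (l : L) (Z : A) (hZ : is_zero Z) (o : option {m : L | m < l}).

(* The last break below l, if any; it determines W_{<l} on every filtration
   with breaks in b. *)
Definition last_break : Prop :=
  if o is Some m then sval m \in b /\ (forall x, x \in b -> x < l -> x <= sval m)
  else forall x, x \in b -> ~~ (x < l).

(** W_{<l} as evaluation at an index that does not depend on F, or as the constant zero; it
    therefore commutes with pointwise kernels and cokernels. *)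
Definition low F : A := if o is Some m then F (sval m) else Z.

Definition low_in F : mor (low F) (F l) :=
  match o as o' return mor (if o' is Some m then F (sval m) else Z) (F l) with
  | Some m => tr F (ltW (svalP m))
  | None => zr S
  end.

Definition low_map F G (f : nattrans F G) : mor (low F) (low G) :=
  match o as o' return mor (if o' is Some m then F (sval m) else Z)
                           (if o' is Some m then G (sval m) else Z) with
  | Some m => f (sval m)
  | None => zr S
  end.

Hypothesis ho : last_break.

Lemma low_natural F G (f : nattrans F G) : f l \oc low_in F = low_in G \oc low_map f.
Proof.
by rewrite /low_in /low_map /low; case: (o) => [m|]; [exact: naturality|rewrite comp0l comp0r].
Qed.

Lemma low_pcoker F G (f : nattrans F G) Q (q : nattrans G Q) :
  pcoker S f q -> coker0 S (low_map f) (low_map q).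
Proof.
move=> h; rewrite /low_map /low; case: (o) => [m|]; first exact: h.
split; first exact: comp0l.
  by move=> T u v _; rewrite (zero_src S u hZ) (zero_src S v hZ).
by move=> T u _; exists (zr S); rewrite comp0l (zero_src S u hZ).
Qed.

Lemma low_pker F G (f : nattrans F G) K (k : nattrans K F) :
  pker S f k -> ker0 S (low_map f) (low_map k).
Proof.
move=> h; rewrite /low_map /low; case: (o) => [m|]; first exact: h.
split; first exact: comp0l.
  by move=> T u v _; rewrite (zero_tgt S u hZ) (zero_tgt S v hZ).
by move=> T u _; exists (zr S); rewrite comp0l (zero_tgt S u hZ).
Qed.

Lemma low_smono F : smono_tr F -> smono S (low_in F).
Proof.
by move=> sF; rewrite /low_in /low; case: (o) => [m|]; [exact: sF|exact: zero_smono].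
Qed.

Lemma below_zero F x : breaks_in F b -> (forall z, z \in b -> ~~ (z < l)) ->
  x < l -> is_zero (F x).
Proof.
move=> [b0 _] no xl; apply: b0 => z zb.
have [lz|zl] := tog_leP hL l z; first exact: lt_le_trans lz.
by move: (no z zb); rewrite zl.
Qed.

Lemma above_last F m x (mx : m <= x) : breaks_in F b ->
  (forall z, z \in b -> z < l -> z <= m) -> x < l -> is_iso (tr F mx).
Proof.
move=> [_ b1] mM xl; apply: b1 => z zb; apply/negP => /andP[mz zx].
by move: (lt_le_trans mz (mM z zb (le_lt_trans zx xl))); rewrite ltxx.
Qed.

Lemma low_lt_sub F : breaks_in F b -> smono_tr F -> lt_sub (low_in F).
Proof.
move=> bF sF; move: ho; rewrite /last_break /low_in /low.
case: (o) => [[m ml] /= [mb mM]|no].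
  by apply: lt_sub_step => // x mx xl; apply: above_last.
by apply: lt_sub_zero => // x xl; apply: below_zero.
Qed.

(** A transition from x < l to l is either a composite through the last break m, or, for x beyond m,
    the transition from m precomposed with an isomorphism. *)
Lemma low_smono_tr F : breaks_in F b -> smono S (low_in F) ->
  (forall y (yl : y < l) x (h : x <= y), y \in b -> smono S (tr F h)) ->
  forall x (h : x <= l), smono S (tr F h).
Proof.
move=> bF; move: ho; rewrite /last_break /low_in /low.
case: (o) => [[m ml] /= [mb mM]|no] sm IH x h; last first.
  have := h; rewrite le_eqVlt => /orP[/eqP e|xl].
    by subst x; rewrite tr_id; apply: (iso_smono S); apply: iso_id.
  by apply: zero_smono; apply: below_zero xl.
have := h; rewrite le_eqVlt => /orP[/eqP e|xl].
  by subst x; rewrite tr_id; apply: (iso_smono S); apply: iso_id.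
rewrite (tr_irr _ _ (ltW ml)) in sm.
have [xm|/ltW mx] := tog_leP hL x m.
  by rewrite -(tr_comp F xm (ltW ml)); apply: (smono_comp (IH _ ml _ xm mb)).
have [g [g1 g2]] : is_iso (tr F mx) by apply: above_last.
have -> : tr F h = tr F (ltW ml) \oc g.
  by rewrite -(tr_comp F mx h (ltW ml)) -comp_assoc g2 comp_idr.
by apply: smono_ext => //; exists (tr F mx).
Qed.

End Below.

Lemma last_break_exists b l : exists o : option {m : L | m < l}, last_break b o.
Proof.
have [no|[m [mb ml mM]]] := last_such b (fun x => x < l); first by exists None.
by exists (Some (exist _ m ml)).
Qed.

(** The order on L need not be well-founded, so the induction is on the number of entries of b below
    l: replacing l by such an entry x lowers it, as x is no longer counted. *)
Lemma break_ind b (P : L -> Prop) :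
  (forall l, (forall x, x \in b -> x < l -> P x) -> P l) -> forall l, P l.
Proof.
move=> h l; have [n] := ubnP (count (fun x => x < l) b).
elim: n l => // n IH l; rewrite ltnS => hn; apply: h => x xb xl; apply: IH.
apply: leq_trans hn; elim: b xb => // a s IHs; rewrite inE /=.
have sub : (count (fun y => (y < x)%R) s <= count (fun y => (y < l)%R) s)%N.
  by apply: sub_count => y /= yx; apply: lt_trans xl.
case/orP=> [/eqP<-|xs]; first by rewrite ltxx xl add0n add1n ltnS.
rewrite -addnS; apply: leq_add; last exact: IHs.
by case: (boolP (a < x)) => // ax; rewrite (lt_trans ax xl).
Qed.

End Filtrations.

(** * Morphisms of filtrations *)

Section FilteredMorphism.
Variables (A : category) (S : qab A) (L : porderZmodType).
Hypotheses (hL : totally_ordered_group L) (hdiv : uniquely_divisible L).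
Variable rk : A -> nat.
Hypothesis hrk : rank_function rk.
Variable deg : A -> L.
Hypothesis hdeg : degree_function deg.
Let mu := slope rk deg.
Hypothesis hmu : slope_function mu.
Variables (M N : functor (poset_cat L) A) (f : nattrans M N) (b : seq L).
Hypotheses (bM : breaks_in M b) (bN : breaks_in N b) (sM : smono_tr S M) (sN : smono_tr S N).
Hypothesis hM : forall l G, is_gr M l G -> quots_ge mu l G.
Hypothesis hN : forall l G, is_gr N l G -> subs_le mu l G.

(** The two claims support each other: the slope bound at one break kills the snake morphism above
    it, which yields strictness and the bound there. *)
Definition strict_at (l : L) : Prop :=
  sfac S (f l) /\ forall Q (q : mor (N l) Q), coker0 S (f l) q -> subs_le mu l Q.

Variables (Z : A) (hZ : is_zero Z).

(** The strict inequality arises here: W_{<l} is W_{<=m} for the last break m below l, so the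
    inductive bound m lies strictly below l. Without such a break the cokernel is zero. *)
Lemma low_strict l (o : option {m : L | m < l}) : last_break b o ->
  (forall x, x \in b -> x < l -> strict_at x) ->
  sfac S (low_map S Z o f) /\
  forall Q (q : mor (low Z o N) Q), coker0 S (low_map S Z o f) q -> subs_lt mu l Q.
Proof.
move=> ho h; move: ho; rewrite /last_break /low_map /low; case: (o) => [[m ml] /= [mb _]|_].
  have [sf hq] := h m mb ml; split=> // Q q /hq hQ; exact: subs_le_lt hQ ml.
split=> [|Q q [_ eq _]]; last by apply: (zero_subs_lt S); apply: (epi_zero S eq).
exists Z, (zr S), (zr S); split; last exact: comp0l.
  exact: (@zero_smono (op A) (op_additive S) Z Z (zr S) (op_zero hZ)).
exact: zero_smono.
Qed.

Lemma gr_ses F l (o : option {m : L | m < l}) : last_break b o ->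
  breaks_in F b -> smono_tr S F ->
  exists G (p : mor (F l) G), ses S (low_in S Z o F) p /\ is_gr F l G.
Proof.
move=> ho bF sF; have [G [p hp]] := has_coker S (low_in S Z o F).
exists G, p; split; first by apply: coker_ses hp _; apply: low_smono.
exact: is_grI (low_lt_sub hL hZ ho bF sF) hp.
Qed.

Lemma strict_everywhere l : strict_at l.
Proof.
elim/(@break_ind L b): l => l IH; have [o ho] := last_break_exists hL b l.
have [sg hQ] := low_strict ho IH.
have [G [p [s /hM hG]]] := gr_ses ho bM sM; have [G' [p' [s' /hN hG']]] := gr_ses ho bN sN.
have [Qg [qg hqg]] := has_coker S (low_map S Z o f).
have comm := low_natural S Z o f.
have hQg := hQ _ _ hqg; split.
  exact: (step_strict hL hdiv hrk hdeg hmu s s' comm hG hG' sg hqg hQg).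
move=> Q q hq.
have [v vE] : exists v, v \oc qg = q \oc low_in S Z o N.
  case: hqg => _ _; apply; rewrite -comp_assoc -comm comp_assoc.
  by case: hq => -> _ _; rewrite comp0l.
exact: (step_subs_le hL hdiv hrk hdeg hmu s s' comm hG hG' hqg hQg hq vE).
Qed.

Section Cokernel.
Variables (Q : functor (poset_cat L) A) (q : nattrans N Q).
Hypothesis hq : pcoker S f q.

Lemma pcoker_breaks : breaks_in Q b.
Proof.
have eq x : is_epi (q x) by case: (hq x).
split=> [x hx|x y h hx]; first by apply: (epi_zero S (eq x)); apply: bN.1.
have [g [g1 g2]] := bM.2 x y h hx; have [k [k1 k2]] := bN.2 x y h hx.
have [u uE] : exists u, u \oc q y = q x \oc k.
  case: (hq y) => _ _; apply.
  have -> : q x \oc k \oc f y = q x \oc (f x \oc g).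
    rewrite -[f y]comp_idr -g2 (comp_assoc (f y)) (naturality f) -!comp_assoc.
    by rewrite (comp_assoc k) k1 comp_idl.
  by rewrite comp_assoc; case: (hq x) => -> _ _; rewrite comp0l.
exists u; split.
  apply: eq; rewrite -comp_assoc -(naturality q) comp_assoc uE -comp_assoc k1.
  by rewrite comp_idr comp_idl.
apply: eq; rewrite -comp_assoc uE comp_assoc -(naturality q) -comp_assoc k2.
by rewrite comp_idr comp_idl.
Qed.

Lemma coker_low l (o : option {m : L | m < l}) : last_break b o ->
  smono S (low_in S Z o Q) /\
  forall W (w : mor (Q l) W), coker0 S (low_in S Z o Q) w ->
    subs_le mu l W /\ forall G, is_gr N l G -> in_slope_subcat mu l G ->
      in_slope_subcat mu l W.
Proof.
move=> ho; have [sg hQ] := low_strict ho (fun x _ _ => strict_everywhere x).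
have [G [p [s /hM hG]]] := gr_ses ho bM sM; have comm := low_natural S Z o f.
have [G' [p' [s' hgr]]] := gr_ses ho bN sN; have hG' := hN hgr.
have hqg := low_pcoker hZ o hq; have hQg := hQ _ _ hqg.
have vE := esym (low_natural S Z o q).
have st := step_coker_smono hL hdiv hrk hdeg hmu s s' comm hG hG' hqg hQg (hq l) vE.
split=> // W w hw; split.
  exact: (step_coker_subs hL hdiv hrk hdeg hmu s s' comm hG hG' hqg (hq l) vE hw).
(* The slope assumption concerns the given model G1, so the step is repeated with its own quotient
   map p1 in place of p'. *)
move=> G1 gG1 sG1.
have [p1 hp1] := is_gr_coker S (low_lt_sub hL hZ ho bN sN) gG1.
have s1 : ses S (low_in S Z o N) p1 by apply: coker_ses hp1 _; apply: low_smono.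
exact: (step_coker_slope hL hdiv hrk hdeg hmu s s1 comm hG (hN gG1) hqg (hq l) vE hw sG1).
Qed.

Lemma pcoker_smono_tr : smono_tr S Q.
Proof.
move=> x y; elim/(@break_ind L b): y x => l IH x h.
have [o ho] := last_break_exists hL b l.
apply: (low_smono_tr hL ho pcoker_breaks (coker_low ho).1) => y yl z zy yb.
exact: IH.
Qed.

Lemma pcoker_gr l W : is_gr Q l W ->
  subs_le mu l W /\
  forall G, is_gr N l G -> in_slope_subcat mu l G -> in_slope_subcat mu l W.
Proof.
have [o ho] := last_break_exists hL b l.
move=> /(is_gr_coker S (low_lt_sub hL hZ ho pcoker_breaks pcoker_smono_tr)) [w hw].
exact: (coker_low ho).2 hw.
Qed.

End Cokernel.

Section Kernel.
Variables (K : functor (poset_cat L) A) (k : nattrans K M).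
Hypothesis hk : pker S f k.

Lemma pker_breaks : breaks_in K b.
Proof.
have mk x : is_monic (k x) by case: (hk x).
split=> [x hx|x y h hx]; first by apply: (monic_zero S (mk x)); apply: bM.1.
have [g [g1 g2]] := bM.2 x y h hx; have [j [j1 j2]] := bN.2 x y h hx.
have [u uE] : exists u, k x \oc u = g \oc k y.
  case: (hk x) => _ _; apply.
  have -> : f x \oc (g \oc k y) = j \oc f y \oc k y.
    rewrite -[f x]comp_idl -j1 -(comp_assoc j) -(naturality f) -!comp_assoc.
    by rewrite (comp_assoc _ g) g2 comp_idl.
  by rewrite -comp_assoc; case: (hk y) => -> _ _; rewrite comp0r.
exists u; split.
  apply: mk; rewrite comp_assoc uE -comp_assoc (naturality k) comp_assoc g1.
  by rewrite comp_idr comp_idl.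
apply: mk; rewrite comp_assoc (naturality k) -comp_assoc uE comp_assoc g2.
by rewrite comp_idr comp_idl.
Qed.

(** Followed by k y, the transition of K becomes that of M after k x, a composite of strict monics;
    strict monics cancel on the left. *)
Lemma pker_smono_tr : smono_tr S K.
Proof.
move=> x y h; apply: (@smono_cancel _ _ _ _ _ _ (k y)).
rewrite (naturality k); apply: smono_comp (sM h).
by exists (N x), (f x); exact: hk.
Qed.

Lemma pker_gr l W : is_gr K l W ->
  quots_ge mu l W /\
  forall G, is_gr M l G -> in_slope_subcat mu l G -> in_slope_subcat mu l W.
Proof.
have [o ho] := last_break_exists hL b l.
move=> /(is_gr_coker S (low_lt_sub hL hZ ho pker_breaks pker_smono_tr)) [w hw].
have [sg hQ] := low_strict ho (fun x _ _ => strict_everywhere x).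
have [G [p [s hgr]]] := gr_ses ho bM sM; have comm := low_natural S Z o f.
have hG := hM hgr.
have [G' [p' [s' /hN hG']]] := gr_ses ho bN sN.
have [Qg [qg hqg]] := has_coker S (low_map S Z o f); have hQg := hQ _ _ hqg.
have hkg := low_pker hZ o hk; have uE := low_natural S Z o k.
split.
  by have [I [k3 [e []]]] := step_ker_gr hL hdiv hrk hdeg hmu s s' comm
    hG hG' sg hqg hQg hkg (hk l) uE hw.
move=> G1 gG1 sG1.
have [p1 hp1] := is_gr_coker S (low_lt_sub hL hZ ho bM sM) gG1.
have s1 : ses S (low_in S Z o M) p1 by apply: coker_ses hp1 _; apply: low_smono.
exact: (step_ker_slope hL hdiv hrk hdeg hmu s1 s' comm (hM gG1) hG'
  sg hqg hQg hkg (hk l) uE hw sG1).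
Qed.

End Kernel.

End FilteredMorphism.

Theorem corollary3p1p12
  (A : category) (hA : quasi_abelian A)
  (L : porderZmodType) (hL : totally_ordered_group L) (hdiv : uniquely_divisible L)
  (rk : A -> nat) (hrk : rank_function rk)
  (deg : A -> L) (hdeg : degree_function deg)
  (hmu : slope_function (slope rk deg))
  (M N : Wpre A L) (f : mor M N)
  (hM : in_udq (slope rk deg) M) (hN : in_uds (slope rk deg) N) :
  ((exists (Q : Wpre A L) (q : mor N Q), is_coker f q) /\
   (forall (Q : Wpre A L) (q : mor N Q), is_coker f q ->
      [/\ @is_coker (Fun (poset_cat L) A) (sval M) (sval N) f (sval Q) q,
          in_uds (slope rk deg) Q
        & in_W (slope rk deg) N -> in_W (slope rk deg) Q])) /\
  ((exists (K : Wpre A L) (k : mor K M), is_ker f k) /\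
   (forall (K : Wpre A L) (k : mor K M), is_ker f k ->
      [/\ @is_ker (Fun (poset_cat L) A) (sval M) (sval N) f (sval K) k,
          in_udq (slope rk deg) K
        & in_W (slope rk deg) M -> in_W (slope rk deg) K])).
Proof.
have [S _] := qab_of hA; have [Z hZ] := null_object S.
have [sM [b1 bM1]] := finite_filtration_breaks S hL (svalP M).
have [sN [b2 bN2]] := finite_filtration_breaks S hL (svalP N).
(* Concatenation gives M and N a common list of breaks, so that one last break below l serves
   both. *)
have bM : breaks_in (sval M) (b1 ++ b2).
  by apply: breaks_inS bM1 => z zb; rewrite mem_cat zb.
have bN : breaks_in (sval N) (b1 ++ b2).
  by apply: breaks_inS bN2 => z zb; rewrite mem_cat zb orbT.
have P0 : @finite_filtration A L (const_zero (poset_cat L) Z).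
  apply: (breaks_finite_filtration (S := S) hL (b := [::])).
    by move=> x y h; apply: zero_smono.
  by split=> [x _|x y h _]; [exact: hZ|exact: iso_id].
split.
- have [Q0 [q0 hq0]] := pcoker_exists S f.
  have Q0f : finite_filtration Q0.
    apply: (breaks_finite_filtration (S := S) hL (b := b1 ++ b2)).
      exact: (pcoker_smono_tr hL hdiv hrk hdeg hmu bM bN sM sN hM hN hZ hq0).
    exact: (pcoker_breaks bM bN hq0).
  have cQ0 := @pcoker_full _ _ _ _ hZ _ M N (exist _ Q0 Q0f) f q0 P0 hq0.
  split; first by exists (exist _ Q0 Q0f), q0.
  move=> Q q cQ; have [t [s [tE st ts]]] := is_coker_iso cQ0 cQ.
  (* Any cokernel in [Wpre] differs from the pointwise one by an isomorphism, which is an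
     isomorphism at every index; hence it is pointwise as well. *)
  have hq : pcoker S f (Q := sval Q) q.
    move=> i; rewrite -tE; apply: (coker_iso (hq0 i)); exists (component s i).
    by split; [exact: (f_equal (fun u : nattrans _ _ => u i) st)
              |exact: (f_equal (fun u : nattrans _ _ => u i) ts)].
  have hgr := pcoker_gr hL hdiv hrk hdeg hmu bM bN sM sN hM hN hZ hq.
  split.
  + exact: pcoker_fun hZ _ _ _ _ _ hq.
  + by move=> l G /hgr [].
  (* [in_W] only speaks about models of gr_l N, so one must be produced before its slope can be
     passed on. *)
  + move=> NW l G /hgr [_ h]; have [G' hG'] := gr_exists hA hL N l.
    exact: h hG' (NW _ _ hG').
- have [K0 [k0 hk0]] := pker_exists S f.
  have K0f : finite_filtration K0.
    apply: (breaks_finite_filtration (S := S) hL (b := b1 ++ b2)).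
      exact: (pker_smono_tr sM hk0).
    exact: (pker_breaks bM bN hk0).
  have cK0 := @pker_full _ _ _ _ hZ _ M N (exist _ K0 K0f) f k0 P0 hk0.
  split; first by exists (exist _ K0 K0f), k0.
  move=> K k cK; have [t [s [tE st ts]]] := is_ker_iso cK0 cK.
  have hk : pker S f (K := sval K) k.
    move=> i; rewrite -tE; apply: (ker_iso (hk0 i)); exists (component s i).
    by split; [exact: (f_equal (fun u : nattrans _ _ => u i) st)
              |exact: (f_equal (fun u : nattrans _ _ => u i) ts)].
  have hgr := pker_gr hL hdiv hrk hdeg hmu bM bN sM sN hM hN hZ hk.
  split.
  + exact: pker_fun hZ _ _ _ _ _ hk.
  + by move=> l G /hgr [].
  + move=> MW l G /hgr [_ h]; have [G' hG'] := gr_exists hA hL M l.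
    exact: h hG' (MW _ _ hG').
Qed.
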